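(* Let $A\in G\text{-}\mathbb{A}^\nu$. For a simplicial set $K$ define $A\otimes|K|:=\operatorname{colim}_{L\subseteq K\text{ finite}}A\otimes|L|$, the colimit in $G\text{-}\mathbb{A}^\nu$ over the finite simplicial subsets $L$ of $K$. Then the functor $A\otimes|-|:\operatorname{sSet}\to G\text{-}\mathbb{A}^\nu$ is a simplicially enriched left adjoint to the functor $\operatorname{Hom}(A,-)_\bullet:G\text{-}\mathbb{A}^\nu\to\operatorname{sSet}$.
   Context: $G$ is a locally compact, second countable group and $\nu$ is a fixed cardinal with $|\nu|\ge 2^{2^{|\mathbb{N}|}}$. A $C^*$-seminorm is a seminorm $p$ on a $*$-algebra with $p(ab)\le p(a)p(b)$, $p(a^* )=p(a)$, $p(a^*a)=p(a)^2$. A $G$-algebra is a topological $*$-algebra (vector space topology, jointly continuous multiplication, continuous involution) with an action of $G$ by bicontinuous $*$-automorphisms such that $g\mapsto g.a$ is continuous for each $a$. An lmc $G$-$C^*$-algebra is a $G$-algebra whose topology is induced by a family of $G$-invariant $C^*$-seminorms; $\mathcal{S}(A)$ is the set of continuous $G$-invariant $C^*$-seminorms on $A$. $\nu$-complete means Hausdorff and every Cauchy $\nu$-sequence (a function $\kappa\to A$ with $\kappa\le\nu$ an ordinal, Cauchy in the usual sense) converges. $G\text{-}\mathbb{A}^\nu$ is the (bicomplete) category of $\nu$-complete lmc $G$-$C^*$-algebras and $G$-equivariant continuous $*$-homomorphisms. For $X$ compact Hausdorff and $B\in G\text{-}\mathbb{A}^\nu$, $\mathcal{C}(X,B)$ is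 the algebra of continuous functions with pointwise operations and action and the topology of uniform convergence (seminorms $\sup_{x\in X}p(f(x))$, $p\in\mathcal{S}(B)$). $\operatorname{Hom}(A,B)_\bullet$ is the simplicial set with $\operatorname{Hom}(A,B)_n:=\operatorname{Hom}(A,\mathcal{C}(|\Delta^n|,B))$; this makes $G\text{-}\mathbb{A}^\nu$ a simplicially enriched category. For $A\in G\text{-}\mathbb{A}^\nu$ and $X$ compact Hausdorff, $A\otimes X\in G\text{-}\mathbb{A}^\nu$ is the universal algebra generated by copies $A_x$ of $A$, $x\in X$, subject to the relation that the natural map $A\times X\to A\otimes X$ is continuous; i.e. it comes with morphisms $i_x:A\to A\otimes X$ such that $(a,x)\mapsto i_x(a)$ is continuous on $A\times X$, and for every $B\in G\text{-}\mathbb{A}^\nu$ and every family of morphisms $\varphi_x:A\to B$ with $(a,x)\mapsto\varphi_x(a)$ continuous there is a unique morphism $\varphi:A\otimes X\to B$ with $\varphi\circ i_x=\varphi_x$ for all $x$. It is functorial in $A$ and $X$. A finite simplicial set is one with finitely many nondegenerate simplices. *)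

(* Defs.v *)
From HB Require Import structures.
From mathcomp Require Import all_boot all_order all_algebra.
From mathcomp Require Import all_classical all_reals topology normedtype.
From mathcomp Require Import complex ring lra.

Set Implicit Arguments.
Unset Strict Implicit.
Unset Printing Implicit Defensive.

Import Order.TTheory GRing.Theory Num.Theory.
Import numFieldNormedType.Exports ComplexField.Normc.

Local Open Scope classical_set_scope.
Local Open Scope ring_scope.

#[local] Obligation Tactic := idtac.

Lemma sub_eq (T : Type) (P : T -> Prop) (x y : {z | P z}) :
  sval x = sval y -> x = y.
Proof.
case: x y => [x Px] [y Py] /= xy; case: _ / xy Py => Py.
by congr exist; exact: Prop_irrelevance.
Qed.

Record category := Category {
  cat_ob :> Type;
  cat_hom : cat_ob -> cat_ob -> Type;
  cat_id : forall X, cat_hom X X;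
  cat_comp : forall X Y Z, cat_hom Y Z -> cat_hom X Y -> cat_hom X Z;
  cat_idl : forall X Y (f : cat_hom X Y), cat_comp (cat_id Y) f = f;
  cat_idr : forall X Y (f : cat_hom X Y), cat_comp f (cat_id X) = f;
  cat_compA : forall W X Y Z
    (h : cat_hom Y Z) (g : cat_hom X Y) (f : cat_hom W X),
    cat_comp h (cat_comp g f) = cat_comp (cat_comp h g) f }.

Arguments cat_hom {_} _ _.
Arguments cat_id {_} _.
Arguments cat_comp {_ _ _ _} _ _.

Record functor (C D : category) := Functor {
  fun_ob :> C -> D;
  fun_map : forall X Y, cat_hom X Y -> cat_hom (fun_ob X) (fun_ob Y);
  fun_map_id : forall X, fun_map (cat_id X) = cat_id (fun_ob X);
  fun_map_comp : forall X Y Z (g : cat_hom Y Z) (f : cat_hom X Y),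
    fun_map (cat_comp g f) = cat_comp (fun_map g) (fun_map f) }.

Record cocone (J C : category) (F : functor J C) := Cocone {
  cocone_apex : C;
  cocone_leg : forall j, cat_hom (F j) cocone_apex;
  cocone_natural : forall i j (u : cat_hom i j),
    cat_comp (cocone_leg j) (fun_map F u) = cocone_leg i }.

Record colimit (J C : category) (F : functor J C) := Colimit {
  colim_cocone :> cocone F;
  colim_desc : forall c : cocone F,
    cat_hom (cocone_apex colim_cocone) (cocone_apex c);
  colim_descE : forall (c : cocone F) j,
    cat_comp (colim_desc c) (cocone_leg colim_cocone j) = cocone_leg c j;
  colim_uniq : forall Z (f g : cat_hom (cocone_apex colim_cocone) Z),
    (forall j, cat_comp f (cocone_leg colim_cocone j)
             = cat_comp g (cocone_leg colim_cocone j)) -> f = g }.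

Record ordmap (m n : nat) := OMap {
  ordmap_fun :> 'I_m.+1 -> 'I_n.+1;
  ordmap_homo : {homo ordmap_fun : i j / (i <= j)%N} }.

Lemma ordmapP m n (t u : ordmap m n) : t =1 u -> t = u.
Proof.
case: t u => [t ht] [u hu] /= /funext tu; case: _ / tu hu => hu.
by congr OMap; exact: Prop_irrelevance.
Qed.

Definition ordmap_id n : ordmap n n := @OMap n n id (fun _ _ h => h).

Definition ordmap_comp l m n (u : ordmap m n) (t : ordmap l m) : ordmap l n :=
  @OMap l n (u \o t) (fun i j h => ordmap_homo u (ordmap_homo t h)).

Definition ordmap_to0 n : ordmap n 0 := @OMap n 0 (fun=> ord0) (fun _ _ _ => leqnn _).

Lemma ordmap_to0_uniq n (t : ordmap n 0) : t = ordmap_to0 n.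
Proof. by apply: ordmapP => i; rewrite [LHS]ord1. Qed.

Record sset := SSet {
  simplices :> nat -> Type;
  sact : forall m n, ordmap m n -> simplices n -> simplices m;
  sact_id : forall n (x : simplices n), sact (ordmap_id n) x = x;
  sact_comp : forall l m n (u : ordmap m n) (t : ordmap l m) (x : simplices n),
    sact (ordmap_comp u t) x = sact t (sact u x) }.

Arguments sact {_ _ _} _ _.

Record sset_hom (K L : sset) := SSetHom {
  shom_fun :> forall n, K n -> L n;
  shom_act : forall m n (t : ordmap m n) (x : K n),
    shom_fun (sact t x) = sact t (shom_fun x) }.

Arguments shom_fun {_ _} _ {_} _.

Lemma sset_homP (K L : sset) (f g : sset_hom K L) :
  (forall n (x : K n), f n x = g n x) -> f = g.
Proof.
case: f g => [f hf] [g hg] /= fg.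
have {}fg : f = g by apply: functional_extensionality_dep => n; exact: funext.
by case: _ / fg hg => hg; congr SSetHom; exact: Prop_irrelevance.
Qed.

Definition sset_id K : sset_hom K K :=
  @SSetHom K K (fun _ x => x) (fun _ _ _ _ => erefl).

Program Definition sset_comp K L M (g : sset_hom L M) (f : sset_hom K L) :
  sset_hom K M := @SSetHom K M (fun n x => g n (f n x)) _.
Next Obligation. by move=> * /=; rewrite !shom_act. Qed.

Program Definition sset_cat : category :=
  @Category sset sset_hom sset_id sset_comp _ _ _.
Next Obligation. by move=> *; apply: sset_homP. Qed.
Next Obligation. by move=> *; apply: sset_homP. Qed.
Next Obligation. by move=> *; apply: sset_homP. Qed.

Program Definition sset_simplex (n : nat) : sset :=
  @SSet (fun m => ordmap m n) (fun _ _ t x => ordmap_comp x t) _ _.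
Next Obligation. by move=> *; apply: ordmapP. Qed.
Next Obligation. by move=> *; apply: ordmapP. Qed.

Program Definition sset_prod (K L : sset) : sset :=
  @SSet (fun n => (K n * L n)%type)
    (fun _ _ t x => (sact t x.1, sact t x.2)) _ _.
Next Obligation. by move=> K L n [x y]; rewrite /= !sact_id. Qed.
Next Obligation. by move=> K L l m n u t [x y]; rewrite /= !sact_comp. Qed.

Definition degenerate (K : sset) n (x : K n) : Prop :=
  exists m (t : ordmap n m) (y : K m),
    [/\ (m < n)%N, (forall j, exists i, t i = j) & x = sact t y].

Definition finite_sset (K : sset) : Prop :=
  finite_set [set x : {n & K n} | ~ degenerate (projT2 x)].

Record ssubset (K : sset) := SSubset {
  ssub_set :> forall n, set (K n);
  ssub_act : forall m n (t : ordmap m n) (x : K n),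
    ssub_set x -> ssub_set (sact t x) }.

Program Definition ssub_sset (K : sset) (L : ssubset K) : sset :=
  @SSet (fun n => {x : K n | L n x})
    (fun _ _ t x => exist _ (sact t (sval x)) (ssub_act t (svalP x))) _ _.
Next Obligation. by move=> *; apply: sub_eq; rewrite /= sact_id. Qed.
Next Obligation. by move=> *; apply: sub_eq; rewrite /= sact_comp. Qed.

Record fin_ssubset (K : sset) := FinSSubset {
  fsub :> ssubset K;
  fsub_finite : finite_sset (ssub_sset fsub) }.

Definition fin_ssubset_le (K : sset) (L L' : fin_ssubset K) : Prop :=
  forall n, L n `<=` L' n.

Program Definition fin_ssubset_cat (K : sset) : category :=
  @Category (fin_ssubset K) (@fin_ssubset_le K)
    (fun _ _ _ h => h) (fun _ _ _ hg hf n x h => hg n x (hf n x h)) _ _ _.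
Next Obligation. by move=> *; exact: Prop_irrelevance. Qed.
Next Obligation. by move=> *; exact: Prop_irrelevance. Qed.
Next Obligation. by move=> *; exact: Prop_irrelevance. Qed.

Program Definition ssub_incl (K : sset) (L L' : ssubset K)
    (h : forall n, L n `<=` L' n) : sset_hom (ssub_sset L) (ssub_sset L') :=
  @SSetHom _ _ (fun n x => exist _ (sval x) (h n _ (svalP x))) _.
Next Obligation. by move=> *; apply: sub_eq. Qed.

Program Definition ssub_image (K K' : sset) (f : sset_hom K K') (L : ssubset K) :
  ssubset K' := @SSubset K' (fun n => f n @` L n) _.
Next Obligation.
move=> K K' f L m n t _ [x Lx <-]; exists (sact t x); first exact: ssub_act.
exact: shom_act.
Qed.

Program Definition ssub_restr (K K' : sset) (f : sset_hom K K') (L : ssubset K) :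
  sset_hom (ssub_sset L) (ssub_sset (ssub_image f L)) :=
  @SSetHom _ _ (fun n x => exist _ (f n (sval x)) _) _.
Next Obligation. by move=> K K' f L n x; exists (sval x) => //; exact: svalP. Qed.
Next Obligation. by move=> *; apply: sub_eq; exact: shom_act. Qed.

Lemma ssub_image_finite (K K' : sset) (f : sset_hom K K') (L : ssubset K) :
  finite_sset (ssub_sset L) -> finite_sset (ssub_sset (ssub_image f L)).
Proof.
move=> finL.
pose F (x : {n & ssub_sset L n}) : {n & ssub_sset (ssub_image f L) n} :=
  existT _ (projT1 x) (ssub_restr f L _ (projT2 x)).
apply: (sub_finite_set _ (finite_image F finL)) => -[n [y Ly]] ndy.
case: (Ly) => x Lx fx.
exists (existT _ n (exist _ x Lx : ssub_sset L n)); last first.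
  by rewrite /F /=; congr existT; apply: sub_eq.
move=> [m [t [z [mn tsurj xz]]]]; apply: ndy.
exists m, t, (ssub_restr f L _ z); split=> //.
apply: sub_eq; move/(congr1 sval): xz => /= xz.
by rewrite -fx xz; exact: shom_act.
Qed.

Definition fin_ssub_image (K K' : sset) (f : sset_hom K K') (L : fin_ssubset K) :
  fin_ssubset K' := FinSSubset (ssub_image_finite f (fsub_finite L)).

(* A simplicial enrichment of an ordinary category [C]: [sc_und] identifies    *)
(* the morphisms of [C] with the 0-simplices of the mapping simplicial sets. *)
Record simplicial_category := SimplicialCategory {
  sc_cat :> category;
  sc_map : sc_cat -> sc_cat -> sset;
  sc_comp : forall X Y Z n, sc_map Y Z n -> sc_map X Y n -> sc_map X Z n;
  sc_und : forall X Y, cat_hom X Y -> sc_map X Y 0;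
  sc_comp_act : forall X Y Z m n (t : ordmap m n)
    (g : sc_map Y Z n) (f : sc_map X Y n),
    sact t (sc_comp g f) = sc_comp (sact t g) (sact t f);
  sc_compA : forall W X Y Z n
    (h : sc_map Y Z n) (g : sc_map X Y n) (f : sc_map W X n),
    sc_comp h (sc_comp g f) = sc_comp (sc_comp h g) f;
  sc_idl : forall X Y n (f : sc_map X Y n),
    sc_comp (sact (ordmap_to0 n) (sc_und (cat_id Y))) f = f;
  sc_idr : forall X Y n (f : sc_map X Y n),
    sc_comp f (sact (ordmap_to0 n) (sc_und (cat_id X))) = f;
  sc_und_bij : forall X Y, bijective (@sc_und X Y);
  sc_und_comp : forall X Y Z (g : cat_hom Y Z) (f : cat_hom X Y),
    sc_und (cat_comp g f) = sc_comp (sc_und g) (sc_und f) }.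

Arguments sc_map {_} _ _.
Arguments sc_comp {_ _ _ _ _} _ _.
Arguments sc_und {_ _ _} _.

Record simplicial_structure (C D : simplicial_category) (F : functor C D) :=
  SimplicialStructure {
  sf_map : forall X Y n, sc_map X Y n -> sc_map (F X) (F Y) n;
  sf_map_act : forall X Y m n (t : ordmap m n) (f : sc_map X Y n),
    sf_map (sact t f) = sact t (sf_map f);
  sf_map_comp : forall X Y Z n (g : sc_map Y Z n) (f : sc_map X Y n),
    sf_map (sc_comp g f) = sc_comp (sf_map g) (sf_map f);
  sf_map_und : forall X Y (f : cat_hom X Y),
    sf_map (sc_und f) = sc_und (fun_map F f) }.

Arguments sf_map {_ _ _} _ {_ _ _} _.

Record simplicial_functor (C D : simplicial_category) := SimplicialFunctor {
  sf_fun :> functor C D;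
  sf_str : simplicial_structure sf_fun }.

Record simplicial_adjunction (C D : simplicial_category)
    (F : simplicial_functor C D) (H : simplicial_functor D C) :=
  SimplicialAdjunction {
  adj : forall X Y n, sc_map (F X) Y n -> sc_map X (H Y) n;
  adj_act : forall X Y m n (t : ordmap m n) (f : sc_map (F X) Y n),
    adj (sact t f) = sact t (adj f);
  adj_bij : forall X Y n, bijective (@adj X Y n);
  adj_natl : forall X X' Y n (f : sc_map (F X) Y n) (k : sc_map X' X n),
    adj (sc_comp f (sf_map (sf_str F) k)) = sc_comp (adj f) k;
  adj_natr : forall X Y Y' n (g : sc_map Y Y' n) (f : sc_map (F X) Y n),
    adj (sc_comp g f) = sc_comp (sf_map (sf_str H) g) (adj f) }.

Definition simplicial_left_adjoint (C D : simplicial_category)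
    (F : functor C D) (H : simplicial_functor D C) : Prop :=
  exists S : simplicial_structure F,
    inhabited (simplicial_adjunction (SimplicialFunctor S) H).

(* [Map(K, L)_n := sSet(K x Delta[n], L)] *)
Program Definition sset_map (K L : sset) : sset :=
  @SSet (fun n => sset_hom (sset_prod K (sset_simplex n)) L)
    (fun m n t f => @SSetHom _ _ (fun k x => f k (x.1, ordmap_comp t x.2)) _) _ _.
Next Obligation.
by move=> K L m n t f k l u [x s] /=; rewrite -shom_act /=; congr (f _ (_, _)); apply: ordmapP.
Qed.
Next Obligation.
by move=> K L n f; apply: sset_homP => k [x s] /=; congr (f _ (_, _)); apply: ordmapP.
Qed.
Next Obligation.
by move=> K L l m n u t f; apply: sset_homP => k [x s] /=; congr (f _ (_, _)); apply: ordmapP.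
Qed.

Program Definition sset_map_comp (K L M : sset) n
    (g : sset_map L M n) (f : sset_map K L n) : sset_map K M n :=
  @SSetHom _ _ (fun k x => g k (f k x, x.2)) _.
Next Obligation.
by move=> K L M n g f m k t x /=; rewrite -[RHS]shom_act /= -shom_act.
Qed.

Program Definition sset_map_und (K L : sset) (f : sset_hom K L) : sset_map K L 0 :=
  @SSetHom _ _ (fun k x => f k x.1) _.
Next Obligation. by move=> *; exact: shom_act. Qed.

Program Definition sset_scat : simplicial_category :=
  @SimplicialCategory sset_cat sset_map sset_map_comp sset_map_und
    _ _ _ _ _ _.
Next Obligation. by move=> *; apply: sset_homP. Qed.
Next Obligation. by move=> *; apply: sset_homP. Qed.
Next Obligation. by move=> *; apply: sset_homP. Qed.
Next Obligation. by move=> *; apply: sset_homP => k [x s]. Qed.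
Next Obligation.
move=> K L.
have hg (f : sset_map K L 0) : forall m n (t : ordmap m n) (x : K n),
  f m (sact t x, ordmap_to0 m) = sact t (f n (x, ordmap_to0 n)).
  by move=> m n t x; rewrite -shom_act; congr (f _ (_, _)); rewrite -(ordmap_to0_uniq (sact _ _)).
exists (fun f : sset_map K L 0 => SSetHom (hg f)); first by move=> f; apply: sset_homP.
by move=> f; apply: sset_homP => n [x s]; rewrite /= (ordmap_to0_uniq s).
Qed.
Next Obligation. by move=> *; apply: sset_homP. Qed.

(** The simplicial functor [C(A, -)] represented by an object [A]. *)
Section representable.
Variables (C : simplicial_category) (A : C).

Program Definition rep_map (X Y : C) n (g : sc_map X Y n) :
  sset_map (sc_map A X) (sc_map A Y) n :=
  @SSetHom _ _ (fun k x => sc_comp (sact x.2 g) x.1) _.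
Next Obligation.
by move=> X Y n g m k t [x s] /=; rewrite sact_comp sc_comp_act.
Qed.

Program Definition rep_fmap (X Y : C) (f : cat_hom X Y) :
  sset_hom (sc_map A X) (sc_map A Y) :=
  @SSetHom _ _ (fun n x => sc_comp (sact (ordmap_to0 n) (sc_und f)) x) _.
Next Obligation.
move=> X Y f m n t x; rewrite sc_comp_act -sact_comp.
by rewrite (ordmap_to0_uniq (ordmap_comp _ _)).
Qed.

Program Definition rep_functor : functor C sset_scat :=
  @Functor C sset_scat (sc_map A) rep_fmap _ _.
Next Obligation. by move=> X; apply: sset_homP => n x /=; rewrite sc_idl. Qed.
Next Obligation.
by move=> X Y Z g f; apply: sset_homP => n x /=; rewrite sc_und_comp sc_comp_act sc_compA.
Qed.

Program Definition rep_structure : simplicial_structure rep_functor :=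
  @SimplicialStructure _ _ _ rep_map _ _ _.
Next Obligation.
by move=> X Y m n t f; apply: sset_homP => k [x s] /=; rewrite -sact_comp.
Qed.
Next Obligation.
by move=> X Y Z n g f; apply: sset_homP => k [x s] /=; rewrite sc_comp_act sc_compA.
Qed.
Next Obligation.
by move=> X Y f; apply: sset_homP => k [x s] /=; rewrite (ordmap_to0_uniq s).
Qed.

Definition rep_sfunctor : simplicial_functor C sset_scat :=
  SimplicialFunctor rep_structure.

End representable.

(* A cardinal is an initial ordinal, i.e. a well-ordered type equipotent to   *)
(* none of its proper initial segments. *)
Record cardinal := Cardinal {
  card_sort :> Type;
  card_lt : card_sort -> card_sort -> Prop;
  card_wf : well_founded card_lt;
  card_trans : forall x y z, card_lt x y -> card_lt y z -> card_lt x z;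
  card_total : forall x y, [\/ card_lt x y, x = y | card_lt y x];
  card_initial : forall x, ~~ ([set: card_sort] #<= [set y | card_lt y x])%card }.

(* The ordinals [k <= nu] are the initial segments of [nu], [nu] included. *)
Definition ordinal_le (nu : cardinal) (k : set nu) : Prop :=
  forall x y, card_lt x y -> k y -> k x.

HB.mixin Record isTopologicalGroup G & Topological G & Group G := {
  mulg_continuous : continuous (fun x : G * G => (x.1 * x.2)%g);
  invg_continuous : continuous (fun x : G => x^-1%g) }.

#[short(type="topologicalGroupType")]
HB.structure Definition TopologicalGroup :=
  {G of isTopologicalGroup G & Topological G & Group G}.

Section seminorms.
Variables (R : realType) (V : lmodType R[i]).
Implicit Types (p : V -> R) (P : set (V -> R)).

Definition seminorm p : Prop :=
  (forall (z : R[i]) a, p (z *: a) = normc z * p a) /\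
  (forall a b, p (a + b) <= p a + p b).

Definition seminorm_nbhs P (a : V) : set_system V :=
  [set U | exists (s : seq (V -> R)) (e : R),
    [/\ forall p, p \in s -> P p, 0 < e &
        [set b | forall p, p \in s -> p (b - a) < e] `<=` U]].

Section seminorm_theory.
Variables (p : V -> R) (hp : seminorm p).

Lemma snZ z a : p (z *: a) = normc z * p a. Proof. exact: hp.1. Qed.
Lemma snD a b : p (a + b) <= p a + p b. Proof. exact: hp.2. Qed.
Lemma sn0 : p 0 = 0. Proof. by rewrite -(scale0r 0) snZ normc0 mul0r. Qed.
Lemma snN a : p (- a) = p a.
Proof.
rewrite -scaleN1r snZ -[RHS]mul1r; congr (_ * _).
by rewrite /= oppr0 sqrrN expr1n expr0n /= addr0 sqrtr1.
Qed.
Lemma sn_sub a b : p (a - b) = p (b - a).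
Proof. by rewrite -opprB snN. Qed.
Lemma snB c a b : p (a - b) <= p (a - c) + p (c - b).
Proof. by rewrite -[a - b](subrKA c) snD. Qed.
Lemma sn_ge0 a : 0 <= p a.
Proof.
have := snD a (- a); rewrite subrr sn0 snN -mulr2n pmulrn_lge0 //.
Qed.
Lemma sn_diff a b : `|p a - p b| <= p (a - b).
Proof.
rewrite ler_norml; apply/andP; split.
  by rewrite lerNl opprB lerBlDr sn_sub -{1}(subrK a b) snD.
by rewrite lerBlDr -{1}(subrK b a) snD.
Qed.

End seminorm_theory.

Variable P : set (V -> R).
Hypothesis hP : forall p, P p -> seminorm p.

Lemma seminorm_nbhs_near p a (e : R) : P p -> 0 < e ->
  seminorm_nbhs P a [set b | p (b - a) < e].
Proof.
move=> Pp e0; exists [:: p], e; split=> //; first by move=> q; rewrite mem_seq1 => /eqP ->.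
by move=> b; apply; rewrite mem_seq1.
Qed.

Lemma seminorm_nbhs_sub (F : set_system V) (a : V) : Filter F ->
  (forall p (e : R), P p -> 0 < e -> F [set b | p (b - a) < e]) ->
  seminorm_nbhs P a `<=` F.
Proof.
move=> FF h U [s [e [sP e0]]]; move=> sU; apply: (filterS sU).
elim: s sP {sU} => [|p s ih] sP; first by apply: filterS filterT.
have Fp : F [set b | p (b - a) < e] by apply: h => //; apply: sP; rewrite mem_head.
have /ih Fs : forall q, q \in s -> P q by move=> q qs; apply: sP; rewrite in_cons qs orbT.
apply: filterS (filterI Fp Fs) => b [pb sb] q; rewrite in_cons => /orP[/eqP -> //|].
exact: sb.
Qed.

Lemma seminorm_nbhs_filter a : ProperFilter (seminorm_nbhs P a).
Proof.
split.
  case=> s [e [sP e0 /(_ a)]]; apply=> p /sP /hP hp.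
  by rewrite subrr (sn0 hp).
split.
- by exists [::], 1.
- move=> U W [s [e [sP e0 sU]]] [t [d [tP d0 tW]]].
  exists (s ++ t), (Num.min e d); split.
  + by move=> p; rewrite mem_cat => /orP[/sP|/tP].
  + by rewrite lt_min e0.
  + move=> b h; split; [apply: sU|apply: tW] => p ps.
      by have := h p; rewrite mem_cat ps lt_min => /(_ isT)/andP[].
    by have := h p; rewrite mem_cat ps orbT lt_min => /(_ isT)/andP[].
- by move=> U W UW [s [e [sP e0 sU]]]; exists s, e; split=> // b /sU /UW.
Qed.

Lemma seminorm_nbhs_singleton a U : seminorm_nbhs P a U -> U a.
Proof.
by case=> s [e [sP e0]]; apply => p /sP /hP hp; rewrite subrr (sn0 hp).
Qed.

Lemma seminorm_nbhs_nbhs a U :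
  seminorm_nbhs P a U -> seminorm_nbhs P a (seminorm_nbhs P ^~ U).
Proof.
case=> s [e [sP e0 sU]]; have e20 : 0 < e / 2 by rewrite divr_gt0.
exists s, (e / 2); split=> // b hb; exists s, (e / 2); split=> // c hc.
apply: sU => p ps; apply: le_lt_trans (snB (hP (sP _ ps)) b _ _) _.
by rewrite [e]splitr ltrD // ?hb ?hc.
Qed.

End seminorms.

(* The vector space [V] with the topology induced by a family of seminorms. *)
Definition seminormed (R : realType) (V : lmodType R[i]) (P : set (V -> R))
  (hP : forall p, P p -> seminorm p) : Type := V.

Section seminormed_topology.
Variables (R : realType) (V : lmodType R[i]) (P : set (V -> R)).
Hypothesis hP : forall p, P p -> seminorm p.

Local Notation W := (seminormed hP).

HB.instance Definition _ := GRing.Lmodule.copy W V.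
HB.instance Definition _ := hasNbhs.Build W (seminorm_nbhs P).
HB.instance Definition _ := Nbhs_isNbhsTopological.Build W
  (seminorm_nbhs_filter hP) (seminorm_nbhs_singleton hP)
  (seminorm_nbhs_nbhs hP).

Lemma cvg_seminormed (F : set_system W) (a : W) : Filter F ->
  (forall p (e : R), P p -> 0 < e -> F [set b | p (b - a) < e]) -> F --> a.
Proof. by move=> FF h; exact: seminorm_nbhs_sub. Qed.

Lemma near_seminormed (a : W) p (e : R) : P p -> 0 < e ->
  \forall b \near a, p (b - a) < e.
Proof. exact: seminorm_nbhs_near. Qed.

Lemma seminormed_add_continuous : continuous (fun x : W * W => x.1 + x.2).
Proof.
case=> a b; apply: cvg_seminormed => p e Pp e0.
have e20 : 0 < e / 2 by rewrite divr_gt0.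
exists ([set x | p (x - a) < e / 2], [set x | p (x - b) < e / 2]).
  by split; exact: near_seminormed.
case=> x y [/= hx hy]; rewrite opprD addrACA (le_lt_trans (snD (hP Pp) _ _)) //.
by rewrite [e]splitr ltrD.
Qed.

HB.instance Definition _ :=
  PreTopologicalNmodule_isTopologicalNmodule.Build W seminormed_add_continuous.

Lemma seminormed_scale_continuous :
  continuous (fun z : R[i]^o * W => z.1 *: z.2).
Proof.
case=> z a; apply: cvg_seminormed => p e Pp e0; have hp := hP Pp.
pose M := normc z + 1 + p a.
have nz (w : R[i]) : 0 <= normc w by case: w => ? ?; exact: sqrtr_ge0.
have M0 : 0 < M by rewrite /M ltr_wpDr ?(sn_ge0 hp) // ltr_wpDl.
pose d := Num.min 1 (e / (2 * M)).
have d0 : 0 < d by rewrite lt_min ltr01 divr_gt0 // mulr_gt0.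
exists ([set w : R[i]^o | normc (w - z) < d], [set x | p (x - a) < d]).
  split; last exact: near_seminormed.
  exists (d%:C)%C; first by rewrite /= ltcR.
  move=> w /=; rewrite distrC => h.
  by have := h; rewrite normc_def ltcR; case: (w - z).
case=> w x [/= hw hx].
have -> : w *: x - z *: a = w *: (x - a) + (w - z) *: a.
  by rewrite scalerBr scalerBl addrA subrK.
apply: le_lt_trans (snD hp _ _) _; rewrite !(snZ hp).
have nw : normc w <= normc z + 1.
  rewrite -[w in X in X <= _](subrK z) addrC.
  apply: le_trans (le_normcD _ _) _; rewrite lerD2l ltW //.
  by apply: lt_le_trans hw _; rewrite ge_min lexx.
apply: le_lt_trans (_ : M * d < e).
  rewrite /M mulrDl lerD //; first by rewrite ler_pM // ?(sn_ge0 hp) // ltW.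
  by rewrite mulrC ler_wpM2l ?(sn_ge0 hp) // ltW.
rewrite mulrC -ltr_pdivlMr //; apply: le_lt_trans (_ : d <= e / (2 * M)) _.
  by rewrite ge_min lexx orbT.
rewrite ltr_pM2l // ltf_pV2 ?posrE ?mulr_gt0 //.
by rewrite ltr_pMl // ltr1n.
Qed.

HB.instance Definition _ :=
  TopologicalNmodule_isTopologicalLmodule.Build R[i] W seminormed_scale_continuous.

End seminormed_topology.

Section galgebras.
Variables (R : realType) (G : topologicalGroupType).
Local Notation C := R[i].

(* A (possibly non-unital) *-algebra with an action of [G] by *-automorphisms. *)
Record gstar_algebra (V : lmodType C) := GStarAlgebra {
  gmul : V -> V -> V;
  gstar : V -> V;
  gact : G -> V -> V;
  gmulA : associative gmul;
  gmulDl : left_distributive gmul +%R;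
  gmulDr : right_distributive gmul +%R;
  gmulZl : forall z a b, gmul (z *: a) b = z *: gmul a b;
  gmulZr : forall z a b, gmul a (z *: b) = z *: gmul a b;
  gstarK : involutive gstar;
  gstarD : {morph gstar : a b / a + b};
  gstarZ : forall z a, gstar (z *: a) = conjc z *: gstar a;
  gstarM : forall a b, gstar (gmul a b) = gmul (gstar b) (gstar a);
  gact1 : forall a, gact 1%g a = a;
  gactA : forall g h a, gact (g * h)%g a = gact g (gact h a);
  gactD : forall g, {morph gact g : a b / a + b};
  gactZ : forall g z a, gact g (z *: a) = z *: gact g a;
  gactM : forall g, {morph gact g : a b / gmul a b};
  gactS : forall g, {morph gact g : a / gstar a} }.

Definition cstar_seminorm (V : lmodType C) (S : gstar_algebra V) (p : V -> R) :
    Prop :=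
  [/\ seminorm p,
      forall a b, p (gmul S a b) <= p a * p b,
      forall a, p (gstar S a) = p a &
      forall a, p (gmul S (gstar S a) a) = p a ^+ 2].

Definition ginvariant (V : lmodType C) (S : gstar_algebra V) (p : V -> R) :
    Prop :=
  forall g a, p (gact S g a) = p a.

Record galgebra := GAlgebra {
  ga_space :> topologicalLmodType C;
  ga_str : gstar_algebra ga_space;
  ga_mul_continuous :
    continuous (fun x : ga_space * ga_space => gmul ga_str x.1 x.2);
  ga_star_continuous : continuous (gstar ga_str);
  ga_act_continuous : forall g, continuous (gact ga_str g);
  ga_orbit_continuous : forall a, continuous (fun g => gact ga_str g a) }.

(* [S(A)] *)
Definition cinv_seminorms (A : galgebra) : set (A -> R) :=
  [set p | [/\ cstar_seminorm (ga_str A) p, ginvariant (ga_str A) p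
             & continuous p]].

Definition is_lmc (A : galgebra) : Prop :=
  exists2 P : set (A -> R),
    (forall p, P p -> cstar_seminorm (ga_str A) p /\ ginvariant (ga_str A) p) &
    forall a : A, nbhs a = seminorm_nbhs P a.

(* Sequences indexed by an ordinal [k <= nu]; [~ card_lt i i0] is [i0 <= i]. *)
Definition seq_cauchy (nu : cardinal) (k : set nu) (A : galgebra) (s : k -> A) :
    Prop :=
  forall U : set A, nbhs 0 U -> exists i0 : k, forall i j : k,
    ~ card_lt (val i) (val i0) -> ~ card_lt (val j) (val i0) -> U (s i - s j).

Definition seq_converges (nu : cardinal) (k : set nu) (A : galgebra)
    (s : k -> A) (l : A) : Prop :=
  forall U : set A, nbhs l U -> exists i0 : k, forall i : k,
    ~ card_lt (val i) (val i0) -> U (s i).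

Definition nu_complete (nu : cardinal) (A : galgebra) : Prop :=
  hausdorff_space A /\
  forall (k : set nu) (s : k -> A), ordinal_le k -> seq_cauchy s ->
    exists l, seq_converges s l.

Record ghom (A B : galgebra) := GHom {
  ghom_fun :> A -> B;
  ghomD : {morph ghom_fun : a b / a + b};
  ghomZ : forall z a, ghom_fun (z *: a) = z *: ghom_fun a;
  ghomM : forall a b,
    ghom_fun (gmul (ga_str A) a b) = gmul (ga_str B) (ghom_fun a) (ghom_fun b);
  ghomS : forall a, ghom_fun (gstar (ga_str A) a) = gstar (ga_str B) (ghom_fun a);
  ghom_act : forall g a,
    ghom_fun (gact (ga_str A) g a) = gact (ga_str B) g (ghom_fun a);
  ghom_continuous : continuous ghom_fun }.

Lemma ghomP (A B : galgebra) (f g : ghom A B) : f =1 g -> f = g.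
Proof.
case: f g => [f ? ? ? ? ? ?] [g ? ? ? ? ? ?] /= /funext fg.
subst g; congr GHom; exact: Prop_irrelevance.
Qed.

Program Definition ghom_id (A : galgebra) : ghom A A := @GHom A A id _ _ _ _ _ _.
Solve All Obligations with by [].
Next Obligation. by move=> A a; apply: cvg_id. Qed.

Program Definition ghom_comp (A B D : galgebra) (g : ghom B D) (f : ghom A B) :
  ghom A D := @GHom A D (g \o f) _ _ _ _ _ _.
Next Obligation. by move=> A B D g f a b /=; rewrite !ghomD. Qed.
Next Obligation. by move=> A B D g f z a /=; rewrite !ghomZ. Qed.
Next Obligation. by move=> A B D g f a b /=; rewrite !ghomM. Qed.
Next Obligation. by move=> A B D g f a /=; rewrite !ghomS. Qed.
Next Obligation. by move=> A B D g f h a /=; rewrite !ghom_act. Qed.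
Next Obligation.
by move=> A B D g f a; apply: continuous_comp; exact: ghom_continuous.
Qed.

Variable nu : cardinal.

Record lmc_algebra := LmcAlgebra {
  lmc_alg :> galgebra;
  lmc_lmc : is_lmc lmc_alg;
  lmc_complete : nu_complete nu lmc_alg }.

Program Definition lmc_cat : category :=
  @Category lmc_algebra ghom ghom_id ghom_comp _ _ _.
Next Obligation. by move=> A B f; apply: ghomP. Qed.
Next Obligation. by move=> A B f; apply: ghomP. Qed.
Next Obligation. by move=> A B D E h g f; apply: ghomP. Qed.

(** Algebras whose topology is given by a family of seminorms. *)

Section seminormed_algebra.
Variables (V : lmodType C) (S : gstar_algebra V) (P : set (V -> R)).
Hypothesis hP : forall p, P p -> seminorm p.
Hypothesis hC : forall p, P p -> cstar_seminorm S p /\ ginvariant S p.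
Hypothesis hO : forall (a : V) (g : G) p (e : R), P p -> 0 < e ->
  \forall h \near g, p (gact S h a - gact S g a) < e.

Let W : topologicalLmodType C := seminormed hP.
Let SW : gstar_algebra W := @GStarAlgebra W (gmul S) (gstar S) (gact S)
  (gmulA S) (gmulDl S) (gmulDr S) (gmulZl S) (gmulZr S)
  (gstarK S) (gstarD S) (gstarZ S) (gstarM S)
  (gact1 S) (gactA S) (gactD S) (gactZ S) (gactM S) (gactS S).

Let mul_diff p a b x y : P p ->
  p (gmul S x y - gmul S a b) <= p x * p (y - b) + p (x - a) * p b.
Proof.
move=> Pp; have [[hp pM _ _] _] := hC Pp.
have -> : gmul S x y - gmul S a b = gmul S x (y - b) + gmul S (x - a) b.
  rewrite gmulDr gmulDl -scaleN1r -[- b]scaleN1r -[- a]scaleN1r gmulZl gmulZr.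
  by rewrite !scaleN1r addrA subrK.
by apply: le_trans (snD hp _ _) _; rewrite lerD.
Qed.

Let star_diff p a b : P p -> p (gstar S b - gstar S a) = p (b - a).
Proof.
move=> Pp; have [[_ _ pS _] _] := hC Pp.
suff -> : gstar S b - gstar S a = gstar S (b - a) by rewrite pS.
by rewrite gstarD -scaleN1r -[in RHS]scaleN1r gstarZ rmorphN1.
Qed.

Let act_diff g p a b : P p -> p (gact S g b - gact S g a) = p (b - a).
Proof.
move=> Pp; have [_ pG] := hC Pp.
suff -> : gact S g b - gact S g a = gact S g (b - a) by rewrite pG.
by rewrite gactD -scaleN1r -[in RHS]scaleN1r gactZ.
Qed.

Let mul_continuous : continuous (fun x : W * W => gmul SW x.1 x.2).
Proof.
case=> a b; apply: (@cvg_seminormed _ _ _ hP) => p e Pp e0; have hp := hP Pp.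
pose M := p a + 1 + p b.
have M0 : 0 < M by rewrite /M ltr_wpDr ?(sn_ge0 hp) // ltr_wpDl // (sn_ge0 hp).
pose d := Num.min 1 (e / (2 * M)).
have d0 : 0 < d by rewrite lt_min ltr01 divr_gt0 // mulr_gt0.
exists ([set x : V | p (x - a) < d], [set x : V | p (x - b) < d]).
  by split; apply: (@near_seminormed _ _ _ hP).
case=> x y [/= hx hy].
apply: le_lt_trans (mul_diff a b x y Pp) _.
have px : p x <= p a + 1.
  rewrite -(subrK a x) addrC; apply: le_trans (snD hp _ _) _; rewrite lerD2l ltW //.
  by apply: lt_le_trans hx _; rewrite ge_min lexx.
apply: le_lt_trans (_ : M * d < e).
  rewrite /M mulrDl lerD //.
    by rewrite ler_pM ?(sn_ge0 hp) // ltW.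
  by rewrite mulrC ler_wpM2l ?(sn_ge0 hp) // ltW.
rewrite mulrC -ltr_pdivlMr //; apply: le_lt_trans (_ : d <= e / (2 * M)) _.
  by rewrite ge_min lexx orbT.
rewrite ltr_pM2l // ltf_pV2 ?posrE ?mulr_gt0 //.
by rewrite ltr_pMl // ltr1n.
Qed.

Let star_continuous : continuous (gstar SW : W -> W).
Proof.
move=> a; apply: (@cvg_seminormed _ _ _ hP _ _
  (@fmap_filter _ _ _ _ (nbhs_filter (a : W)))) => p e Pp e0.
change (nbhs (a : W) [set b : V | p (gstar S b - gstar S a) < e]).
rewrite (_ : [set _ | _] = [set b : V | p (b - a) < e]).
  exact: (@near_seminormed _ _ _ hP).
by apply/funext => b /=; rewrite star_diff.
Qed.

Let act_continuous g : continuous (gact SW g : W -> W).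
Proof.
move=> a; apply: (@cvg_seminormed _ _ _ hP _ _
  (@fmap_filter _ _ _ _ (nbhs_filter (a : W)))) => p e Pp e0.
change (nbhs (a : W) [set b : V | p (gact S g b - gact S g a) < e]).
rewrite (_ : [set _ | _] = [set b : V | p (b - a) < e]).
  exact: (@near_seminormed _ _ _ hP).
by apply/funext => b /=; rewrite act_diff.
Qed.

Let orbit_continuous (a : W) : continuous (fun g => gact SW g a).
Proof. move=> g; apply: (@cvg_seminormed _ _ _ hP _ _
  (@fmap_filter _ _ _ _ (nbhs_filter g))) => p e Pp e0.
exact: hO. Qed.

Definition seminormed_galgebra : galgebra :=
  GAlgebra mul_continuous star_continuous act_continuous orbit_continuous.

Lemma seminormed_is_lmc : is_lmc seminormed_galgebra.
Proof. by exists P. Qed.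

End seminormed_algebra.

End galgebras.

Section function_algebras.
Variables (R : realType) (G : topologicalGroupType).
Local Notation C := R[i].

Lemma near_cinv (A : galgebra R G) (p : A -> R) (a : A) (e : R) :
  seminorm p -> continuous p -> 0 < e -> \forall b \near a, p (b - a) < e.
Proof.
move=> hp cp e0.
have h : {for a, continuous (fun b => p (b - a))}.
  apply: (continuous_comp (f := fun b => b - a)); last exact: cp.
  apply: (@continuous_comp _ _ _ (fun b => (b, a)) (fun x : A * A => x.1 - x.2)).
    by apply: cvg_pair => /=; [exact: cvg_id|exact: cvg_cst].
  exact: sub_continuous.
have /cvgrPdist_lt/(_ _ e0) := h.
apply: filterS => b; rewrite subrr (sn0 hp) sub0r normrN.
exact/le_lt_trans/ler_norm.
Qed.

Lemma family_continuous (A : galgebra R G) (P : set (A -> R)) (p : A -> R) :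
  (forall a : A, nbhs a = seminorm_nbhs P a) -> P p -> seminorm p ->
  continuous p.
Proof.
move=> nP Pp hp b; apply/cvgrPdist_lt => d d0.
suff h : seminorm_nbhs P b [set c | `|p b - p c| < d] by rewrite -nP in h.
exists [:: p], d; split=> //; first by move=> q; rewrite mem_seq1 => /eqP ->.
move=> c /(_ p (mem_head _ _)) /=; rewrite (sn_sub hp) => h.
exact: le_lt_trans (sn_diff hp _ _) h.
Qed.

Lemma lmc_nbhs (A : galgebra R G) (a : A) : is_lmc A ->
  nbhs a = seminorm_nbhs (@cinv_seminorms _ _ A) a.
Proof.
case=> P hP nP; apply/seteqP; split.
  rewrite nP => U [s [e [sP e0 sU]]]; exists s, e; split=> // p /sP Pp.
  have [cp ip] := hP _ Pp; split=> //; have [hp _ _ _] := cp.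
  exact: family_continuous hp.
apply: seminorm_nbhs_sub => p e [[hp _ _ _] _ cp] e0.
exact: near_cinv.
Qed.

Lemma lmc_cvg (A : galgebra R G) (F : set_system A) (a : A) : is_lmc A ->
  Filter F ->
  (forall p (e : R), cinv_seminorms p -> 0 < e -> F [set b | p (b - a) < e]) ->
  F --> a.
Proof.
by move=> lA FF h; rewrite /cvg_to lmc_nbhs //; exact: seminorm_nbhs_sub.
Qed.

Record compHaus := CompHaus {
  ch_space :> topologicalType;
  ch_compact : compact [set: ch_space];
  ch_hausdorff : hausdorff_space ch_space }.

Definition cfun (X : topologicalType) (B : galgebra R G) : Type :=
  continuousType X B.

Section cfun_algebra.
Variables (X : topologicalType) (B : galgebra R G).
Implicit Types f h : cfun X B.

Definition mk_cfun (f : X -> B) (cf : continuous f) : cfun X B := mkcts cf.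

Lemma cfun_continuous f : continuous (f : X -> B).
Proof. exact: cts_fun. Qed.

Lemma cfunP f h : (forall x, f x = h x) -> f = h.
Proof. by move=> fh; apply/continuousEP. Qed.

Let op2_continuous (op : B -> B -> B) f h :
  continuous (fun x : B * B => op x.1 x.2) -> continuous (fun x => op (f x) (h x)).
Proof.
move=> cop x.
apply: (@continuous_comp _ _ _ (fun x => (f x, h x)) (fun x : B * B => op x.1 x.2)).
  by apply: cvg_pair => /=; exact: cfun_continuous.
exact: cop.
Qed.

Let op1_continuous (op : B -> B) f : continuous op -> continuous (fun x => op (f x)).
Proof. by move=> cop x; apply: continuous_comp; [exact: cfun_continuous|exact: cop]. Qed.

Let scale_op_continuous (z : C) : continuous (fun b : B => z *: b).
Proof.
move=> b.
apply: (@continuous_comp _ _ _ (fun b => (z : C^o, b)) (fun x : C^o * B => x.1 *: x.2)).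
  by apply: (@cvg_pair _ _ _ _ (nbhs (z : C^o))); [exact: cvg_cst|exact: cvg_id].
exact: scale_continuous.
Qed.

Definition cfun0 : cfun X B := mk_cfun (@cst_continuous X B 0).
Definition cfun_add f h := mk_cfun (@op2_continuous _ f h (@add_continuous B)).
Definition cfun_opp f := mk_cfun (@op1_continuous _ f (@opp_continuous B)).
Definition cfun_scale z f := mk_cfun (@op1_continuous _ f (@scale_op_continuous z)).
Definition cfun_mul f h := mk_cfun (@op2_continuous _ f h (@ga_mul_continuous _ _ B)).
Definition cfun_star f := mk_cfun (@op1_continuous _ f (@ga_star_continuous _ _ B)).
Definition cfun_act g f := mk_cfun (@op1_continuous _ f (@ga_act_continuous _ _ B g)).

HB.instance Definition _ := Choice.on (cfun X B).

Program Definition cfun_zmod := @GRing.isZmodule.Build (cfun X B)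
  cfun0 cfun_opp cfun_add _ _ _ _.
Next Obligation. by move=> f h k; apply: cfunP => x; exact: addrA. Qed.
Next Obligation. by move=> f h; apply: cfunP => x; exact: addrC. Qed.
Next Obligation. by move=> f; apply: cfunP => x; exact: add0r. Qed.
Next Obligation. by move=> f; apply: cfunP => x; exact: addNr. Qed.
HB.instance Definition _ := cfun_zmod.

Program Definition cfun_lmod := @GRing.Zmodule_isLmodule.Build C (cfun X B)
  cfun_scale _ _ _ _.
Next Obligation. by move=> a b f; apply: cfunP => x; exact: scalerA. Qed.
Next Obligation. by move=> f; apply: cfunP => x; exact: scale1r. Qed.
Next Obligation. by move=> a f h; apply: cfunP => x; exact: scalerDr. Qed.
Next Obligation. by move=> f a b; apply: cfunP => x; exact: scalerDl. Qed.
HB.instance Definition _ := cfun_lmod.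

Program Definition cfun_str : gstar_algebra G (cfun X B) :=
  @GStarAlgebra R G (cfun X B) cfun_mul cfun_star cfun_act
    _ _ _ _ _ _ _ _ _ _ _ _ _ _ _.
Next Obligation. by move=> f h k; apply: cfunP => x; exact: gmulA. Qed.
Next Obligation. by move=> f h k; apply: cfunP => x; exact: gmulDl. Qed.
Next Obligation. by move=> f h k; apply: cfunP => x; exact: gmulDr. Qed.
Next Obligation. by move=> z f h; apply: cfunP => x; exact: gmulZl. Qed.
Next Obligation. by move=> z f h; apply: cfunP => x; exact: gmulZr. Qed.
Next Obligation. by move=> f; apply: cfunP => x; exact: gstarK. Qed.
Next Obligation. by move=> f h; apply: cfunP => x; exact: gstarD. Qed.
Next Obligation. by move=> z f; apply: cfunP => x; exact: gstarZ. Qed.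
Next Obligation. by move=> f h; apply: cfunP => x; exact: gstarM. Qed.
Next Obligation. by move=> f; apply: cfunP => x; exact: gact1. Qed.
Next Obligation. by move=> g g' f; apply: cfunP => x; exact: gactA. Qed.
Next Obligation. by move=> g f h; apply: cfunP => x; exact: gactD. Qed.
Next Obligation. by move=> g z f; apply: cfunP => x; exact: gactZ. Qed.
Next Obligation. by move=> g f h; apply: cfunP => x; exact: gactM. Qed.
Next Obligation. by move=> g f; apply: cfunP => x; exact: gactS. Qed.

Definition sup_seminorm (p : B -> R) : cfun X B -> R :=
  fun f => sup (range (fun x => p (f x))).

End cfun_algebra.

Section sup_seminorms.
Variables (X : compHaus) (B : galgebra R G).
Implicit Types f h : cfun X B.

Lemma sup_ub (p : B -> R) f x : continuous p -> p (f x) <= sup_seminorm p f.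
Proof.
move=> cp; have : has_sup (range (fun x => p (f x))).
  apply: compact_has_sup; first by exists (p (f x)), x.
  apply: continuous_compact; last exact: ch_compact.
  apply: continuous_subspaceT => y.
  by apply: continuous_comp; [exact: cfun_continuous|exact: cp].
by move=> hs; apply: ub_le_sup; [exact: hs.2|exists x].
Qed.

Lemma sup_le (p : B -> R) f c : 0 <= c -> (forall x, p (f x) <= c) ->
  sup_seminorm p f <= c.
Proof.
move=> c0 h; rewrite /sup_seminorm.
have [/set0P ne|/negbNE/eqP ->] := boolP (range (fun x => p (f x)) != set0).
  by apply: ge_sup => // _ [x _ <-].
by rewrite sup0.
Qed.

Lemma sup_ge0 (p : B -> R) f : seminorm p -> continuous p -> 0 <= sup_seminorm p f.
Proof.
move=> hp cp; rewrite /sup_seminorm.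
have [/set0P [_ [x _ _]]|/negbNE/eqP ->] := boolP (range (fun x => p (f x)) != set0).
  by apply: le_trans (sup_ub f x cp); exact: sn_ge0.
by rewrite sup0.
Qed.

Lemma sup_cstar (p : B -> R) : cinv_seminorms p ->
  cstar_seminorm (cfun_str X B) (sup_seminorm p) /\
  ginvariant (cfun_str X B) (sup_seminorm p).
Proof.
move=> [[hp pM pS pC] pG cp].
have ge0 f : 0 <= sup_seminorm p f by exact: sup_ge0.
have nz (w : C) : 0 <= normc w by case: w => ? ?; exact: sqrtr_ge0.
have scale_le z f : sup_seminorm p (z *: f) <= normc z * sup_seminorm p f.
  apply: sup_le => [|x]; first by rewrite mulr_ge0.
  by rewrite [p _](snZ hp) ler_wpM2l // sup_ub.
split; [split; [split|..]|].
- move=> z f; apply/eqP; rewrite eq_le scale_le /=.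
  have [->|z0] := eqVneq z 0; first by rewrite normc0 mul0r.
  have nz0 : 0 < normc z.
    by rewrite lt_neqAle nz andbT eq_sym; apply: contra_neq z0; exact: eq0_normc.
  rewrite -ler_pdivlMl //.
  have := scale_le z^-1 (z *: f); rewrite scalerA mulVf // scale1r normcV.
  by [].
- move=> f h; apply: sup_le => [|x]; first by rewrite addr_ge0.
  by apply: le_trans (snD hp _ _) _; rewrite lerD // sup_ub.
- move=> f h; apply: sup_le => [|x]; first by rewrite mulr_ge0.
  by apply: le_trans (pM _ _) _; rewrite ler_pM ?(sn_ge0 hp) // sup_ub.
- by move=> f; congr sup; congr image; apply/funext => x; exact: pS.
- move=> f; apply/eqP; rewrite eq_le; apply/andP; split.
    apply: sup_le => [|x]; first by rewrite sqr_ge0.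
    by rewrite [p _]pC ler_sqr ?nnegrE ?(sn_ge0 hp) // sup_ub.
  rewrite -[leRHS]sqr_sqrtr // ler_sqr ?nnegrE ?sqrtr_ge0 //.
  apply: sup_le => [|x]; first exact: sqrtr_ge0.
  rewrite -[leLHS]ger0_norm ?(sn_ge0 hp) // -sqrtr_sqr ler_wsqrtr // -pC.
  exact: (sup_ub (gmul (cfun_str X B) (gstar (cfun_str X B) f) f)).
- by move=> g f; congr sup; congr image; apply/funext => x; exact: pG.
Qed.

End sup_seminorms.

End function_algebras.

Section function_lmc_algebras.
Variables (R : realType) (G : topologicalGroupType) (nu : cardinal).
Local Notation C := R[i].
Local Notation lmc := (lmc_algebra R G nu).

Section cx.
Variables (X : compHaus) (B : lmc).

Definition cx_seminorms : set (cfun X B -> R) :=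
  [set sup_seminorm p | p in @cinv_seminorms _ _ B].

Lemma cx_cstar q : cx_seminorms q ->
  cstar_seminorm (cfun_str X B) q /\ ginvariant (cfun_str X B) q.
Proof. by case=> p hp <-; exact: sup_cstar. Qed.

Lemma cx_seminorm q : cx_seminorms q -> seminorm q.
Proof. by move=> /cx_cstar[[]]. Qed.

Lemma cx_orbit (f : cfun X B) (g : G) q (e : R) : cx_seminorms q -> 0 < e ->
  \forall h \near g, q (gact (cfun_str X B) h f - gact (cfun_str X B) g f) < e.
Proof.
case=> p [[hp pM pS pC] pG cp] <- e0.
have e60 : 0 < e / 2 / 3 by rewrite !divr_gt0.
have pd (k : G) (a b : B) :
    p (gact (ga_str B) k a - gact (ga_str B) k b) = p (a - b).
  by rewrite -scaleN1r -gactZ -gactD scaleN1r pG.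
have cov : near_covering [set: X] by apply/compact_near_coveringP; exact: ch_compact.
have := cov G (nbhs g) (fun h x =>
  p (gact (ga_str B) h (f x) - gact (ga_str B) g (f x)) <= e / 2) (nbhs_filter g).
move=> /(_ _)/wrap[].
  move=> x0 _.
  exists ([set x | p (f x - f x0) < e / 2 / 3],
    [set h | p (gact (ga_str B) h (f x0) - gact (ga_str B) g (f x0)) < e / 2 / 3]).
    split.
      exact: (@cfun_continuous _ _ _ _ f x0 _ (near_cinv (f x0) hp cp e60)).
    exact: (@ga_orbit_continuous _ _ B (f x0) g _ (near_cinv _ hp cp e60)).
  case=> x h [/= hx hh].
  apply: le_trans (snB hp (gact (ga_str B) h (f x0)) _ _) _; rewrite pd.
  apply: le_trans (lerD (lexx _) (snB hp (gact (ga_str B) g (f x0)) _ _)) _.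
  rewrite pd [X in _ + (_ + X)](sn_sub hp).
  have -> : e / 2 = e / 2 / 3 + (e / 2 / 3 + e / 2 / 3).
    by field.
  by rewrite !lerD // ltW.
apply: filterS => h hh; apply: le_lt_trans (_ : e / 2 < e).
  by apply: sup_le => [|x]; [rewrite divr_ge0 // ltW|exact: hh].
by rewrite ltr_pdivrMr // ltr_pMr // ltr1n.
Qed.

Definition cx_galgebra : galgebra R G :=
  seminormed_galgebra cx_seminorm cx_cstar cx_orbit.

Lemma cx_lmc : is_lmc cx_galgebra. Proof. exact: seminormed_is_lmc. Qed.

Definition cx_eval (f : cx_galgebra) (x : X) : B := (f : cfun X B) x.

Lemma cx_eval_continuous (f : cx_galgebra) : continuous (cx_eval f).
Proof. exact: (@cfun_continuous _ _ _ _ (f : cfun X B)). Qed.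

Lemma near_cx (f : cx_galgebra) p (e : R) : @cinv_seminorms _ _ B p -> 0 < e ->
  \forall h \near f, forall x, p (cx_eval h x - cx_eval f x) < e.
Proof.
move=> hp e0.
have hq : cx_seminorms (sup_seminorm p) by exists p.
have := @near_seminormed _ _ _ cx_seminorm f _ _ hq e0.
apply: filterS => h hh x; apply: le_lt_trans hh.
have [_ _ cp] := hp.
exact: (@sup_ub _ _ X B p ((h : cfun X B) - (f : cfun X B)) x cp).
Qed.

Lemma cx_eval_at_continuous x : continuous (cx_eval ^~ x).
Proof.
move=> f; apply: (@lmc_cvg _ _ B _ _ (lmc_lmc B)
  (@fmap_filter _ _ _ _ (nbhs_filter f))) => p e hp e0.
by apply: filterS (near_cx f hp e0) => h; apply.
Qed.

Lemma cx_hausdorff : hausdorff_space cx_galgebra.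
Proof.
move=> f h fh; apply: (@cfunP _ _ X B) => x.
apply: (lmc_complete B).1 => U W nU nW.
have fU := @cx_eval_at_continuous x f U nU.
have hW := @cx_eval_at_continuous x h W nW.
by have [k [kU kW]] := fh _ _ fU hW; exists (cx_eval k x).
Qed.

Section cauchy.
Variables (k : set nu) (s : k -> cx_galgebra).
Hypotheses (ord_k : ordinal_le k) (cauchy_s : seq_cauchy s).

Let ile (i j : k) := ~ card_lt (val j) (val i).

Let irr (i : nu) : ~ card_lt i i.
Proof. by elim/(well_founded_ind (@card_wf nu)): i => i ih h; exact: (ih i h h). Qed.

Let ile_trans i j l : ile i j -> ile j l -> ile i l.
Proof.
move=> ij jl li; case: (card_total (val i) (val j)) => [ij'|ij'|//].
  exact: jl (card_trans li ij').
by apply: jl; rewrite -ij'.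
Qed.

Let ile_max i j : exists l, ile i l /\ ile j l.
Proof.
have [ij|nij] := pselect (card_lt (val i) (val j)).
  by exists j; split; [move=> ji; exact: irr (card_trans ij ji)|exact: irr].
by exists i; split; [exact: irr|].
Qed.

Let tail : set_system k := [set Q | exists i0, forall i, ile i0 i -> Q i].

Let tail_filter : ProperFilter tail.
Proof.
split; first by case=> i /(_ i); apply; exact: irr.
split.
- have [i0 _] := cauchy_s filterT; by exists i0.
- move=> P Q [i hi] [j hj]; have [l [il jl]] := ile_max i j.
  by exists l => m lm; split; [apply: hi|apply: hj]; exact: ile_trans lm.
- by move=> P Q PQ [i hi]; exists i => j /hi /PQ.
Qed.

Let cauchy_unif p (e : R) : @cinv_seminorms _ _ B p -> 0 < e ->
  exists i0, forall i j, ile i0 i -> ile i0 j ->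
    forall x, p (cx_eval (s i) x - cx_eval (s j) x) < e.
Proof.
move=> hp e0; have [i0 hi0] := cauchy_s (near_cx 0 hp e0).
exists i0 => i j ii jj x; have := hi0 i j ii jj x.
by rewrite [cx_eval 0 x]/(0 : B) subr0.
Qed.

Let eval_lim x : exists l : B, cx_eval (s i) x @[i --> tail] --> l.
Proof.
have [|l hl] := (lmc_complete B).2 k (fun i => cx_eval (s i) x) ord_k.
  move=> U nU.
  have n0 : nbhs (0 : cx_galgebra) ((cx_eval ^~ x) @^-1` U).
    exact: (@cx_eval_at_continuous x 0 U nU).
  have [i0 hi0] := cauchy_s n0; exists i0 => i j ii jj.
  exact: (hi0 i j ii jj).
by exists l => U /hl [i0 hi0]; exists i0.
Qed.

Let lim x : B := projT1 (cid (eval_lim x)).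

Let lim_cvg x : cx_eval (s i) x @[i --> tail] --> lim x.
Proof. exact: projT2 (cid (eval_lim x)). Qed.

Let lim_unif p (e : R) : @cinv_seminorms _ _ B p -> 0 < e ->
  exists i0, forall i, ile i0 i -> forall x, p (lim x - cx_eval (s i) x) < e.
Proof.
move=> hp e0; have e20 : 0 < e / 2 by rewrite divr_gt0.
have [[sp _ _ _] _ cp] := hp.
have [i0 hi0] := cauchy_unif hp e20; exists i0 => i ii x.
have [j0 hj0] := @lim_cvg x _ (near_cinv (lim x) sp cp e20).
have [j [ij jj]] := ile_max i0 j0.
apply: le_lt_trans (snB sp (cx_eval (s j) x) _ _) _.
rewrite [e]splitr ltrD ?hi0 // (sn_sub sp); exact: hj0.
Qed.

Let lim_continuous : continuous lim.
Proof.
move=> x; apply: (@lmc_cvg _ _ B _ _ (lmc_lmc B)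
  (@fmap_filter _ _ _ _ (nbhs_filter x))) => p e hp e0.
have e30 : 0 < e / 3 by rewrite divr_gt0.
have [[sp _ _ _] _ cp] := hp.
have [i0 /(_ i0 (@irr _)) hi] := lim_unif hp e30.
have hc : nbhs x [set y | p (cx_eval (s i0) y - cx_eval (s i0) x) < e / 3].
  exact: (@cx_eval_continuous (s i0) x _ (near_cinv _ sp cp e30)).
suff: nbhs x [set y | p (lim y - lim x) < e] by [].
apply: (@filterS _ _ (nbhs_filter x) _ _ _ hc) => y hy.
apply: le_lt_trans (snB sp (cx_eval (s i0) y) _ _) _.
apply: le_lt_trans (lerD (lexx _) (snB sp (cx_eval (s i0) x) _ _)) _.
have -> : e = e / 3 + (e / 3 + e / 3) by field.
by rewrite !ltrD // (sn_sub sp).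
Qed.

Lemma cx_seq_complete : exists l, seq_converges s l.
Proof.
pose L : cx_galgebra := mk_cfun lim_continuous.
exists L => U nU.
have sub : seminorm_nbhs cx_seminorms (L : cfun X B) `<=` s @ tail.
  apply: (@seminorm_nbhs_sub _ _ _ (s @ tail) _
    (@fmap_filter _ _ _ _ (@filter_filter _ _ tail_filter))).
  move=> _ e [p hp <-] e0; have e20 : 0 < e / 2 by rewrite divr_gt0.
  have [i0 hi0] := lim_unif hp e20; exists i0 => i ii.
  have [[sp _ _ _] _ cp] := hp.
  apply: le_lt_trans (_ : e / 2 < e); last first.
    by rewrite ltr_pdivrMr // ltr_pMr // ltr1n.
  apply: sup_le => [|x]; first exact: ltW.
  by apply: ltW; have := hi0 i ii x; rewrite (sn_sub sp).
exact: sub nU.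
Qed.

End cauchy.

Lemma cx_complete : nu_complete nu cx_galgebra.
Proof. by split; [exact: cx_hausdorff|exact: cx_seq_complete]. Qed.

Definition cx : lmc := LmcAlgebra cx_lmc cx_complete.

End cx.
End function_lmc_algebras.

Section geometric_simplices.
Variable R : realType.

Definition simplex_set (n : nat) : set 'rV[R]_n.+1 :=
  [set x | (forall i, 0 <= x ord0 i) /\ \sum_i x ord0 i = 1].

Lemma sum_coord_continuous n (P : pred 'I_n) :
  continuous (fun x : 'rV[R]_n => \sum_(i | P i) x ord0 i).
Proof.
apply: (@continuous_big _ _ _ _ _ (@add_continuous R^o)) => i _.
exact: coord_continuous.
Qed.

Lemma simplex_set_compact n : compact (@simplex_set n).
Proof.
apply: bounded_closed_compact.
  exists 1; split=> [|M M1 x [x0 x1]]; first exact: num_real.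
  rewrite /= (_ : `|x| = mx_norm x) // mx_normrE; apply: bigmax_le => [|[i j] _ /=].
    exact: le_trans ler01 (ltW M1).
  rewrite (ord1 i) ger0_norm //; apply: le_trans (ltW M1); rewrite -x1.
  rewrite (bigD1 j) //= lerDl; exact: sumr_ge0.
have -> : @simplex_set n = (\bigcap_(i : 'I_n.+1) ((fun x => x ord0 i) @^-1` [set r | 0 <= r]))
    `&` ((fun x => \sum_i x ord0 i) @^-1` [set 1]).
  by apply/seteqP; split=> x [h1 h2]; split=> // i; [move=> _|]; apply: h1.
apply: closedI.
  apply: closed_bigI => i _; apply: preimage_closed; last exact: closed_ge.
  by move=> x _; exact: coord_continuous.
apply: preimage_closed; last exact: closed_eq.
by move=> x _; exact: (@sum_coord_continuous _ xpredT).
Qed.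

Lemma set_type_compact (T : topologicalType) (S : set T) :
  compact S -> compact [set: S].
Proof.
move=> cS F FF _.
have FS : F (val @^-1` S) by apply: filterE => x; exact: set_mem (valP x).
have [x [Sx clx]] := cS (val @ F) (fmap_proper_filter _ _) FS.
exists (SigSub (mem_set Sx)); split=> // P Q FP [_ [[W oW <-]] Wx sWQ].
have FvP : F [set y : S | (val @` P) (val y)].
  by apply: filterS FP => y Py; exists y.
have nW : nbhs x W by apply: open_nbhs_nbhs.
have [_ [[y Py <-] Wy]] := clx _ _ FvP nW.
by exists y; split=> //; exact: sWQ.
Qed.

Lemma set_type_hausdorff (T : topologicalType) (S : set T) :
  hausdorff_space T -> hausdorff_space S.
Proof.
move=> hT x y xy; apply: val_inj; apply: hT => P Q xP yQ.
have cv : continuous (val : S -> T) by exact: initial_continuous.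
by have [z [Pz Qz]] := xy _ _ (cv x _ xP) (cv y _ yQ); exists (val z).
Qed.

(* [|Delta^n|] *)
Definition simplex (n : nat) : compHaus :=
  CompHaus (set_type_compact (@simplex_set_compact n))
    (set_type_hausdorff (@norm_hausdorff _ _)).

Definition simplex_push m n (t : ordmap m n) (x : 'rV[R]_m.+1) : 'rV[R]_n.+1 :=
  \row_j \sum_(i | t i == j) x ord0 i.

Lemma simplex_push_subproof m n (t : ordmap m n) (x : simplex m) :
  simplex_push t (val x) \in @simplex_set n.
Proof.
case: x => x /= /set_mem[x0 x1]; apply/mem_set; split=> [j|].
  by rewrite mxE; exact: sumr_ge0.
rewrite -x1 [RHS](partition_big t xpredT) //=.
by apply: eq_bigr => j _; rewrite mxE.
Qed.

Definition simplex_map m n (t : ordmap m n) (x : simplex m) : simplex n :=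
  SigSub (simplex_push_subproof t x).

Lemma simplex_map_continuous m n (t : ordmap m n) : continuous (simplex_map t).
Proof.
apply: continuous_comp_initial => x U [P xP PU].
suff h : forall i j, nbhs x [set y : simplex m | P i j (simplex_push t (val y) i j)].
  suff: nbhs x [set y : simplex m | U (simplex_push t (val y))] by [].
  have hf := @filter_forall _ _ _ _ (nbhs_filter x)
    (fun i => @filter_forall _ _ _ _ (nbhs_filter x) (h i)).
  apply: (@filterS _ _ (nbhs_filter x) _ _ _ hf) => y hy; exact: PU.
move=> i j; rewrite (ord1 i).
have cj : continuous (fun y : simplex m => simplex_push t (val y) ord0 j).
  move=> y; rewrite /simplex_push.
  under eq_fun do rewrite mxE.
  apply: (@continuous_comp _ _ _ (val : simplex m -> 'rV[R]_m.+1)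
    (fun x : 'rV[R]_m.+1 => \sum_(i | t i == j) x ord0 i)).
    exact: initial_continuous.
  exact: sum_coord_continuous.
exact: (cj x _ (xP ord0 j)).
Qed.

Lemma simplex_map_id n (x : simplex n) : simplex_map (ordmap_id n) x = x.
Proof.
apply: val_inj; apply/rowP => j; rewrite mxE (big_pred1 j) //.
Qed.

Lemma simplex_map_comp l m n (u : ordmap m n) (t : ordmap l m) (x : simplex l) :
  simplex_map (ordmap_comp u t) x = simplex_map u (simplex_map t x).
Proof.
apply: val_inj; apply/rowP => j; rewrite !mxE /=.
rewrite (partition_big t (fun i => u i == j)) //=.
apply: eq_bigr => i /eqP ui; rewrite mxE; apply: eq_bigl => k.
by case: (t k =P i) => [->|_]; rewrite ?andbF // ui eqxx.
Qed.

Lemma simplex0_uniq (x y : simplex 0) : x = y.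
Proof.
apply: val_inj; apply/rowP => j; rewrite (ord1 j).
case: x y => [x /= /set_mem[_ x1]] [y /= /set_mem[_ y1]].
by move: x1 y1; rewrite !big_ord1 => -> ->.
Qed.

Lemma simplex0_subproof : const_mx 1 \in @simplex_set 0.
Proof. by apply/mem_set; split=> [i|]; rewrite ?big_ord1 mxE. Qed.

Definition simplex0 : simplex 0 := SigSub simplex0_subproof.

End geometric_simplices.

Section realization.
Variables (R : realType) (K : sset).

(* The coproduct of the simplices [|Delta^n|] over all [n] and all [k : K n]. *)
Definition cells : topologicalType :=
  {k : {classic {n & K n}} & (simplex R (projT1 k) : topologicalType)}.

Definition cell n (k : K n) (x : simplex R n) : cells :=
  existT _ (existT _ n k : {classic {n & K n}}) x.

Inductive cell_glue : cells -> cells -> Prop :=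
  CellGlue m n (t : ordmap m n) (k : K n) (x : simplex R m) :
    cell_glue (cell (sact t k) x) (cell k (simplex_map t x)).

Definition cell_eq (c d : cells) : bool :=
  `[< Relation_Operators.clos_refl_sym_trans _ cell_glue c d >].

Lemma cell_eq_refl : reflexive cell_eq.
Proof. by move=> c; apply/asboolP; exact: Relation_Operators.rst_refl. Qed.

Lemma cell_eq_sym : symmetric cell_eq.
Proof.
by move=> c d; apply/asboolP/asboolP => h; exact: Relation_Operators.rst_sym.
Qed.

Lemma cell_eq_trans : transitive cell_eq.
Proof.
move=> d c e /asboolP cd /asboolP de; apply/asboolP.
exact: Relation_Operators.rst_trans cd de.
Qed.

Canonical cell_equiv := EquivRel cell_eq cell_eq_refl cell_eq_sym cell_eq_trans.

(* The geometric realization [|K|]. *)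
Definition realization : topologicalType :=
  quotient_topology {eq_quot cell_equiv}%qT.

Definition realize_pi (c : cells) : realization :=
  (\pi_(quotient_topology {eq_quot cell_equiv}%qT) c)%qT.

Definition realize_repr (p : realization) : cells :=
  repr (p : quotient_topology {eq_quot cell_equiv}%qT).

Lemma realize_reprK p : realize_pi (realize_repr p) = p.
Proof. exact: reprK. Qed.

Lemma realize_piP c d : realize_pi c = realize_pi d <-> cell_eq c d.
Proof. by split=> [/eqquotP|h]; [|apply/eqquotP]. Qed.

Lemma realize_pi_continuous : continuous realize_pi.
Proof. exact: pi_continuous. Qed.

End realization.

Section realization_map.
Variable R : realType.

Definition cell_map (K L : sset) (f : sset_hom K L) (c : cells R K) : cells R L :=
  cell (f _ (projT2 (projT1 c))) (projT2 c).

Lemma cell_map_eq (K L : sset) (f : sset_hom K L) (c d : cells R K) :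
  cell_eq c d -> cell_eq (cell_map f c) (cell_map f d).
Proof.
move=> /asboolP h; apply/asboolP; elim: h => {c d}.
- move=> _ _ [m n t k x]; apply: Relation_Operators.rst_step.
  by rewrite /cell_map /= shom_act; exact: CellGlue.
- by move=> c; exact: Relation_Operators.rst_refl.
- by move=> c d _ h; exact: Relation_Operators.rst_sym.
- by move=> c d e _ h _; exact: Relation_Operators.rst_trans.
Qed.

Lemma cell_map_continuous (K L : sset) (f : sset_hom K L) :
  continuous (@cell_map K L f).
Proof.
apply/continuousP => U oU; apply/sigT_openP => -[n k].
exact: (proj1 (sigT_openP _) oU (existT _ n (f n k))).
Qed.

Definition realize_map (K L : sset) (f : sset_hom K L) (p : realization R K) :
    realization R L :=
  realize_pi (cell_map f (realize_repr p)).

Lemma realize_mapE (K L : sset) (f : sset_hom K L) (c : cells R K) :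
  realize_map f (realize_pi c) = realize_pi (cell_map f c).
Proof.
apply/realize_piP/cell_map_eq; apply/realize_piP; exact: realize_reprK.
Qed.

Lemma realize_map_continuous (K L : sset) (f : sset_hom K L) :
  continuous (realize_map f).
Proof.
apply/quotient_continuous => c.
have -> : realize_map f \o \pi%qT = @realize_pi R L \o cell_map f.
  by apply/funext => d; exact: realize_mapE.
by apply: continuous_comp; [exact: cell_map_continuous|exact: realize_pi_continuous].
Qed.

Lemma realize_map_id (K : sset) (p : realization R K) :
  realize_map (sset_id K) p = p.
Proof.
rewrite -[p]realize_reprK realize_mapE; congr realize_pi.
by case: (realize_repr p) => -[].
Qed.

Lemma realize_map_comp (K L M : sset) (g : sset_hom L M) (f : sset_hom K L)
    (p : realization R K) :
  realize_map (sset_comp g f) p = realize_map g (realize_map f p).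
Proof. by rewrite -[p]realize_reprK !realize_mapE. Qed.

End realization_map.

Section lmc_simplicial.
Variables (R : realType) (G : topologicalGroupType) (nu : cardinal).
Local Notation lmc := (lmc_algebra R G nu).

Lemma seminorm_continuous (A B : galgebra R G) (P : set (B -> R)) (T : A -> B) :
  (forall b : B, nbhs b = seminorm_nbhs P b) ->
  (forall a b, T (a - b) = T a - T b) ->
  (forall p, P p -> exists q : A -> R,
    [/\ seminorm q, continuous q & forall a, p (T a) <= q a]) ->
  continuous T.
Proof.
move=> nP TB hT a; rewrite /continuous_at /cvg_to nP.
apply: (@seminorm_nbhs_sub _ _ _ _ _ (@fmap_filter _ _ _ _ (nbhs_filter a))).
move=> p e Pp e0; have [q [sq cq pq]] := hT p Pp.
apply: (@filterS _ _ (nbhs_filter a) _ _ _ (near_cinv a sq cq e0)) => b.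
by apply: le_lt_trans; rewrite /= -TB.
Qed.

Lemma sup_cinv (X : compHaus) (B : lmc) (p : B -> R) :
  cinv_seminorms p -> @cinv_seminorms _ _ (cx X B) (sup_seminorm p).
Proof.
move=> hp; have [cs ci] := sup_cstar X hp; split=> //.
have [ss _ _ _] := cs.
apply: (@family_continuous _ _ (cx X B) (@cx_seminorms _ _ _ X B)) => //.
by exists p.
Qed.

Let ghomB (A B : galgebra R G) (f : ghom A B) a b : f (a - b) = f a - f b.
Proof. by rewrite ghomD -scaleN1r ghomZ scaleN1r. Qed.

Lemma ghom_cinv (A B : galgebra R G) (f : ghom A B) (p : B -> R) :
  cinv_seminorms p -> cinv_seminorms (p \o f).
Proof.
case=> [[[pZ pD] pM pS pC] pG cp]; split; [split; [split|..]|..] => /=.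
- by move=> z a; rewrite ghomZ.
- by move=> a b; rewrite ghomD.
- by move=> a b; rewrite ghomM.
- by move=> a; rewrite ghomS.
- by move=> a; rewrite ghomM ghomS.
- by move=> g a /=; rewrite ghom_act.
- by move=> a; apply: continuous_comp; [exact: ghom_continuous|exact: cp].
Qed.

Section maps.
Variables (X Y : compHaus) (B D : lmc).

Lemma cx_evalP (f h : cx X B) : (forall x, cx_eval f x = cx_eval h x) -> f = h.
Proof. exact: cfunP. Qed.

Program Definition cx_map (f : ghom B D) : ghom (cx X B) (cx X D) :=
  @GHom _ _ (cx X B) (cx X D)
    (fun h => @mk_cfun _ _ X D (fun x => f (cx_eval h x)) _) _ _ _ _ _ _.
Next Obligation.
move=> f h x; apply: continuous_comp; first exact: cx_eval_continuous.
exact: ghom_continuous.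
Qed.
Next Obligation. by move=> f h k; apply: cfunP => x; exact: ghomD. Qed.
Next Obligation. by move=> f z h; apply: cfunP => x; exact: ghomZ. Qed.
Next Obligation. by move=> f h k; apply: cfunP => x; exact: ghomM. Qed.
Next Obligation. by move=> f h; apply: cfunP => x; exact: ghomS. Qed.
Next Obligation. by move=> f g h; apply: cfunP => x; exact: ghom_act. Qed.
Next Obligation.
move=> f; apply: (@seminorm_continuous (cx X B) (cx X D) (@cx_seminorms _ _ _ X D)) => //.
  by move=> h k; apply: cfunP => x; exact: ghomB.
move=> _ [p hp <-]; have hpf := ghom_cinv f hp.
have [[sq _ _ _] _ cq] := sup_cinv X hpf.
by exists (sup_seminorm (p \o f)); split.
Qed.

Program Definition cx_pre (u : Y -> X) (cu : continuous u) :
    ghom (cx X B) (cx Y B) :=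
  @GHom _ _ (cx X B) (cx Y B)
    (fun h => @mk_cfun _ _ Y B (fun y => cx_eval h (u y)) _) _ _ _ _ _ _.
Next Obligation.
move=> u cu h x; apply: continuous_comp; first exact: cu.
exact: cx_eval_continuous.
Qed.
Next Obligation. by move=> u cu h k; apply: cfunP. Qed.
Next Obligation. by move=> u cu z h; apply: cfunP. Qed.
Next Obligation. by move=> u cu h k; apply: cfunP. Qed.
Next Obligation. by move=> u cu h; apply: cfunP. Qed.
Next Obligation. by move=> u cu g h; apply: cfunP. Qed.
Next Obligation.
move=> u cu.
apply: (@seminorm_continuous (cx X B) (cx Y B) (@cx_seminorms _ _ _ Y B)) => //.
  by move=> h k; apply: cfunP.
move=> _ [p hp <-]; have [[sq _ _ _] _ cq] := sup_cinv X hp.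
exists (sup_seminorm p); split=> // h; have [[sp _ _ _] _ cp] := hp.
by apply: sup_le => [|y]; [exact: sup_ge0|exact: (@sup_ub _ _ X B p h (u y))].
Qed.

Program Definition cx_const : ghom B (cx X B) :=
  @GHom _ _ B (cx X B) (fun b => @mk_cfun _ _ X B (fun=> b) _) _ _ _ _ _ _.
Next Obligation. by move=> b; exact: cst_continuous. Qed.
Next Obligation. by move=> a b; apply: cfunP. Qed.
Next Obligation. by move=> z b; apply: cfunP. Qed.
Next Obligation. by move=> a b; apply: cfunP. Qed.
Next Obligation. by move=> b; apply: cfunP. Qed.
Next Obligation. by move=> g b; apply: cfunP. Qed.
Next Obligation.
apply: (@seminorm_continuous B (cx X B) (@cx_seminorms _ _ _ X B)) => //.
  by move=> a b; apply: cfunP.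
move=> _ [p hp <-]; have [[sp _ _ _] _ cp] := hp.
by exists p; split=> // b; apply: sup_le => [|x //]; exact: sn_ge0.
Qed.

Program Definition cx_ev (x : X) : ghom (cx X B) B :=
  @GHom _ _ (cx X B) B (fun h => cx_eval h x) _ _ _ _ _ _.
Solve All Obligations with by [].
Next Obligation. by move=> x; exact: cx_eval_at_continuous. Qed.

(* The diagonal [C(X, C(X, B)) -> C(X, B)]. *)
Program Definition cx_diag : ghom (cx X (cx X B)) (cx X B) :=
  @GHom _ _ (cx X (cx X B)) (cx X B)
    (fun h => @mk_cfun _ _ X B (fun x => cx_eval (cx_eval h x) x) _) _ _ _ _ _ _.
Next Obligation.
move=> h x; apply: (@lmc_cvg _ _ B _ _ (lmc_lmc B)
  (@fmap_filter _ _ _ _ (nbhs_filter x))) => p e hp e0.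
have e20 : 0 < e / 2 by rewrite divr_gt0.
have [[sp _ _ _] _ cp] := hp.
suff: nbhs x [set y | p (cx_eval (cx_eval h y) y - cx_eval (cx_eval h x) x) < e].
  by [].
have h1 : nbhs x [set y | forall z, p (cx_eval (cx_eval h y) z - cx_eval (cx_eval h x) z) < e / 2].
  exact: (@cx_eval_continuous _ _ _ X (cx X B) h x _ (near_cx _ hp e20)).
have h2 : nbhs x [set y | p (cx_eval (cx_eval h x) y - cx_eval (cx_eval h x) x) < e / 2].
  exact: (@cx_eval_continuous _ _ _ X B (cx_eval h x) x _ (near_cinv _ sp cp e20)).
apply: (@filterS _ _ (nbhs_filter x) _ _ _ (filterI h1 h2)) => y [/(_ y) /= h3 h4].
apply: le_lt_trans (snB sp (cx_eval (cx_eval h x) y) _ _) _.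
by rewrite [e]splitr ltrD.
Qed.
Next Obligation. by move=> h k; apply: cfunP. Qed.
Next Obligation. by move=> z h; apply: cfunP. Qed.
Next Obligation. by move=> h k; apply: cfunP. Qed.
Next Obligation. by move=> h; apply: cfunP. Qed.
Next Obligation. by move=> g h; apply: cfunP. Qed.
Next Obligation.
apply: (@seminorm_continuous (cx X (cx X B)) (cx X B) (@cx_seminorms _ _ _ X B)) => //.
  by move=> h k; apply: cfunP.
move=> _ [p hp <-]; have [[sp _ _ _] _ cp] := hp.
have hq := sup_cinv X hp; have [[sq _ _ _] _ cq] := hq.
have [[sqq _ _ _] _ cqq] := sup_cinv X hq.
exists (sup_seminorm (sup_seminorm p : cx X B -> R)); split=> // h.
apply: sup_le => [|x]; first exact: sup_ge0.
apply: le_trans (@sup_ub _ _ X (cx X B) (sup_seminorm p) h x cq).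
exact: (@sup_ub _ _ X B p (cx_eval h x) x cp).
Qed.

End maps.
(* [Hom(A, B)_n := Hom(A, C(|Delta^n|, B))] *)
Program Definition lmc_hom (A B : lmc) : sset :=
  @SSet (fun n => ghom A (cx (simplex R n) B))
    (fun m n t f => ghom_comp (cx_pre B (@simplex_map_continuous R m n t)) f) _ _.
Next Obligation.
move=> A B n f; apply: ghomP => a; apply: cfunP => x /=.
by rewrite /mkcts /= simplex_map_id.
Qed.
Next Obligation.
move=> A B l m n u t f; apply: ghomP => a; apply: cfunP => x /=.
by rewrite /mkcts /= simplex_map_comp.
Qed.

Definition lmc_comp (A B D : lmc) n (g : lmc_hom B D n) (f : lmc_hom A B n) :
  lmc_hom A D n :=
  ghom_comp (cx_diag (simplex R n) D) (ghom_comp (cx_map (simplex R n) g) f).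

Definition lmc_und (A B : lmc) (f : ghom A B) : lmc_hom A B 0 :=
  ghom_comp (cx_const (simplex R 0) B) f.

Program Definition lmc_scat : simplicial_category :=
  @SimplicialCategory (lmc_cat R G nu) lmc_hom lmc_comp lmc_und _ _ _ _ _ _.
Next Obligation. by move=> A B D m n t g f; apply: ghomP => a; apply: cfunP. Qed.
Next Obligation. by move=> A B D E n h g f; apply: ghomP => a; apply: cfunP. Qed.
Next Obligation. by move=> A B n f; apply: ghomP => a; apply: cfunP. Qed.
Next Obligation. by move=> A B n f; apply: ghomP => a; apply: cfunP. Qed.
Next Obligation.
move=> A B; exists (fun f => ghom_comp (cx_ev B (simplex0 R)) f) => f.
  by apply: ghomP.
apply: ghomP => a; apply: cfunP => x /=.
by rewrite /mkcts (simplex0_uniq x (simplex0 R)).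
Qed.
Next Obligation. by move=> A B D g f; apply: ghomP => a; apply: cfunP. Qed.

(* [A (x) X]: the universal algebra generated by copies [A_x] of [A], [x : X], *)
(* such that [A * X -> A (x) X] is continuous. *)
Record tensor (A : lmc) (X : topologicalType) := Tensor {
  tens_alg :> lmc;
  tens_in : X -> ghom A tens_alg;
  tens_continuous : continuous (fun z : A * X => tens_in z.2 z.1);
  tens_desc : forall (B : lmc) (f : X -> ghom A B),
    continuous (fun z : A * X => f z.2 z.1) -> ghom tens_alg B;
  tens_descE : forall (B : lmc) (f : X -> ghom A B)
    (cf : continuous (fun z : A * X => f z.2 z.1)) x,
    ghom_comp (tens_desc cf) (tens_in x) = f x;
  tens_uniq : forall (B : lmc) (f g : ghom tens_alg B),
    (forall x, ghom_comp f (tens_in x) = ghom_comp g (tens_in x)) -> f = g }.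

Section tensor_functoriality.
Variables (A : lmc).

Lemma tens_map_subproof (X Y : topologicalType) (T : tensor A Y) (u : X -> Y) :
  continuous u -> continuous (fun z : A * X => tens_in T (u z.2) z.1).
Proof.
move=> cu z.
apply: (@continuous_comp _ _ _ (fun z : A * X => (z.1, u z.2))
  (fun z : A * Y => tens_in T z.2 z.1)); last exact: tens_continuous.
apply: cvg_pair => /=; first exact: cvg_fst.
by apply: (@continuous_comp _ _ _ snd u); [exact: cvg_snd|exact: cu].
Qed.

(* [A (x) u : A (x) X -> A (x) Y] *)
Definition tens_map (X Y : topologicalType) (S : tensor A X) (T : tensor A Y)
    (u : X -> Y) (cu : continuous u) : ghom S T :=
  @tens_desc _ _ S T (fun x => tens_in T (u x)) (@tens_map_subproof X Y T u cu).

Lemma tens_mapE (X Y : topologicalType) (S : tensor A X) (T : tensor A Y)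
    (u : X -> Y) (cu : continuous u) x :
  ghom_comp (tens_map S T cu) (tens_in S x) = tens_in T (u x).
Proof. by rewrite /tens_map tens_descE. Qed.

Variable T : forall L : sset, finite_sset L -> tensor A (realization R L).

(* [A (x) |f| : A (x) |L| -> A (x) |L'|] *)
Definition fin_map (L L' : sset) (finL : finite_sset L) (finL' : finite_sset L')
    (f : sset_hom L L') : ghom (T finL) (T finL') :=
  tens_map (T finL) (T finL') (@realize_map_continuous R L L' f).

Lemma fin_map_id (L : sset) (finL : finite_sset L) :
  fin_map finL finL (sset_id L) = ghom_id _.
Proof.
apply: tens_uniq => x; rewrite tens_mapE realize_map_id.
by apply: ghomP.
Qed.

Lemma fin_map_comp (L L' L'' : sset) (finL : finite_sset L)
    (finL' : finite_sset L') (finL'' : finite_sset L'')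
    (g : sset_hom L' L'') (f : sset_hom L L') :
  fin_map finL finL'' (sset_comp g f)
    = ghom_comp (fin_map finL' finL'' g) (fin_map finL finL' f).
Proof.
apply: tens_uniq => x; rewrite tens_mapE realize_map_comp.
rewrite -(tens_mapE (T finL') _ (@realize_map_continuous R L' L'' g)).
rewrite -(tens_mapE (T finL) _ (@realize_map_continuous R L L' f)).
by apply: ghomP.
Qed.

(* The diagram [L |-> A (x) |L|] over the finite simplicial subsets of [K]. *)
Program Definition tens_diagram (K : sset) :
    functor (fin_ssubset_cat K) (lmc_cat R G nu) :=
  @Functor (fin_ssubset_cat K) (lmc_cat R G nu)
    (fun L => T (fsub_finite L))
    (fun L L' h => fin_map (fsub_finite L) (fsub_finite L') (ssub_incl h)) _ _.
Next Obligation.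
move=> K L /=; rewrite -fin_map_id; congr fin_map.
by apply: sset_homP => n x; apply: sub_eq.
Qed.
Next Obligation.
move=> K L L' L'' g f /=; rewrite -fin_map_comp; congr fin_map.
by apply: sset_homP => n x; apply: sub_eq.
Qed.

(* A choice of [A (x) |K| := colim_L A (x) |L|] for all simplicial sets [K]. *)
Variable colim : forall K : sset, colimit (tens_diagram K).

Definition tens_ob (K : sset) : lmc := cocone_apex (colim K).

Definition tens_leg (K : sset) (L : fin_ssubset K) :
    ghom (T (fsub_finite L)) (tens_ob K) :=
  cocone_leg (colim K) L.

Program Definition tens_cocone (K K' : sset) (f : sset_hom K K') :
    cocone (tens_diagram K) :=
  @Cocone _ _ (tens_diagram K) (tens_ob K')
    (fun L => ghom_comp (tens_leg (fin_ssub_image f L))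
      (fin_map (fsub_finite L) (fsub_finite (fin_ssub_image f L))
        (ssub_restr f L))) _.
Next Obligation.
move=> K K' f L L' h /=.
have fh : fin_ssubset_le (fin_ssub_image f L) (fin_ssub_image f L').
  by move=> n _ [x Lx <-]; exists x => //; exact: h.
rewrite -[tens_leg (fin_ssub_image f L)](cocone_natural (colim K') fh) /=.
apply: ghomP => a /=.
rewrite -![fin_map _ _ _ (fin_map _ _ _ _)]/(ghom_comp _ _ a) -!fin_map_comp.
congr (_ (fin_map _ _ _ _)).
by apply: sset_homP => n x; apply: sub_eq.
Qed.

(* [A (x) |f|] is the morphism that restricts, on each finite [L], to          *)
(* [A (x) |L| -> A (x) |f(L)| -> A (x) |K'|]. *)
Definition tens_fmap (K K' : sset) (f : sset_hom K K') :
    ghom (tens_ob K) (tens_ob K') :=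
  colim_desc (colim K) (tens_cocone f).

Lemma tens_fmapE (K K' : sset) (f : sset_hom K K') (L : fin_ssubset K) :
  ghom_comp (tens_fmap f) (tens_leg L) = cocone_leg (tens_cocone f) L.
Proof. exact: (colim_descE (colim K) (tens_cocone f) L). Qed.

Lemma tens_leg_le (K : sset) (L L' : fin_ssubset K) (h : fin_ssubset_le L L') :
  ghom_comp (tens_leg L')
    (fin_map (fsub_finite L) (fsub_finite L') (ssub_incl h)) = tens_leg L.
Proof. exact: (cocone_natural (colim K) h). Qed.

Lemma tens_ob_uniq (K : sset) (B : lmc) (f g : ghom (tens_ob K) B) :
  (forall L, ghom_comp f (@tens_leg K L) = ghom_comp g (tens_leg L)) -> f = g.
Proof. exact: (@colim_uniq _ _ _ (colim K) B f g). Qed.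

Lemma ghom_compA (A1 A2 A3 A4 : galgebra R G) (h : ghom A3 A4) (g : ghom A2 A3)
    (f : ghom A1 A2) : ghom_comp h (ghom_comp g f) = ghom_comp (ghom_comp h g) f.
Proof. exact: ghomP. Qed.

(* The functor [A (x) |-| : sSet -> lmc]. *)
Program Definition tens_functor : functor sset_cat (lmc_cat R G nu) :=
  @Functor sset_cat (lmc_cat R G nu) tens_ob tens_fmap _ _.
Next Obligation.
move=> K; apply: tens_ob_uniq => L; rewrite tens_fmapE /=.
have h : fin_ssubset_le L (fin_ssub_image (sset_id K) L).
  by move=> n x Lx; exists x.
rewrite -(tens_leg_le h); apply: ghomP => a /=.
congr (_ (fin_map _ _ _ _)).
by apply: sset_homP => n x; apply: sub_eq.
Qed.
Next Obligation.
move=> K K' K'' g f; apply: tens_ob_uniq => L; rewrite [LHS]tens_fmapE /=.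
rewrite -ghom_compA; apply: esym.
etransitivity; first exact: (congr1 (ghom_comp (tens_fmap g)) (tens_fmapE f L)).
rewrite /= ghom_compA.
etransitivity; first exact: (congr1 (fun k => ghom_comp k _)
  (tens_fmapE g (fin_ssub_image f L))).
rewrite /= -ghom_compA; apply: esym.
have h : fin_ssubset_le (fin_ssub_image (sset_comp g f) L)
    (fin_ssub_image g (fin_ssub_image f L)).
  by move=> n _ [x Lx <-]; exists (f n x) => //; exists x.
rewrite -(tens_leg_le h) -!ghom_compA -!fin_map_comp.
congr ghom_comp; congr fin_map.
by apply: sset_homP => n x; apply: sub_eq.
Qed.

End tensor_functoriality.
(* The simplicial functor [Hom(A, -)_.]. *)
Definition hom_functor (A : lmc) : simplicial_functor lmc_scat sset_scat :=
  @rep_sfunctor lmc_scat A.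

End lmc_simplicial.

(* Main.v *)
Require Import Defs.
From mathcomp Require Import all_boot all_order all_algebra.
From mathcomp Require Import all_classical all_reals topology normedtype.
From mathcomp Require Import lra zify.

Set Implicit Arguments.
Unset Strict Implicit.
Unset Printing Implicit Defensive.

Import Order.TTheory GRing.Theory Num.Theory.

Local Open Scope classical_set_scope.
Local Open Scope ring_scope.

#[local] Obligation Tactic := idtac.

(** The functor F = A (x) |-| comes with morphisms copies K : K -> Hom(A, F K) of
simplicial sets, sending an n-simplex x to the family, indexed by |Delta^n|, of
the copies of A that sit in A (x) |L| at the points of the cell x, for any
finite L containing x. Everything follows from two facts about them.

Universality ([copies_desc], [copies_uniq]): a morphism F K -> B is the same
thing as a simplicial map K -> Hom(A, B). For finite L a simplicial map
L -> Hom(A, B) is a compatible family of continuous families over the cells, so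
it glues to a family of morphisms A -> B indexed by |L|. Its joint continuity on
A * |L| does not follow formally, as A * - need not preserve quotients; it
holds because finitely many compact cells cover |L|, so that the seminorms of
the cells bound the whole family equicontinuously
([finite_cover_joint_continuous]).

Products of simplices: the n-simplices of Hom(F K, B) are the morphisms
F K -> C(|Delta^n|, B), hence by universality the compatible families
A -> C(|Delta^m|, C(|Delta^n|, B)) over the m-simplices of K, whereas a
simplicial map K x Delta[n] -> Hom(A, B) only provides morphisms
A -> C(|Delta^l|, B) for each m-simplex of K and each pair of monotone maps (u, s)
from [l] to [m] and [n]. The two agree because |Delta^m| x |Delta^n| is the quotient of the
simplices |Delta^l| along the maps (|u|, |s|). That these are jointly
surjective is [common_refinement]: two points of simplices are partitions of
the unit interval, and these have a common refinement. Applied once more to two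
points with the same image, the refinement shows that only the simplicial
relations are divided out ([refinement_indep]).

So transposition along the copies is a bijection in every simplicial degree
([copies_transpose_bij]), and such a bijection carries the simplicial structure
of F and the adjunction with it ([copower_left_adjoint]). *)

(** * Simplicial left adjoints from a universal family *)

Section copower_adjunction.
Variables (D : simplicial_category) (A : D) (F : functor sset_cat D).
Variable eta : forall K : sset, sset_hom K (sc_map A (F K)).
Arguments eta {K}.

Program Definition transpose (K : sset) (Y : D) n (f : sc_map (F K) Y n) :
    sset_map K (sc_map A Y) n :=
  @SSetHom _ _ (fun m x => sc_comp (sact x.2 f) (eta _ x.1)) _.
Next Obligation.
by move=> K Y n f l m t [x s] /=; rewrite sact_comp shom_act sc_comp_act.
Qed.

Lemma transpose_act (K : sset) (Y : D) m n (t : ordmap m n) (f : sc_map (F K) Y n) :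
  transpose (sact t f) = sact t (transpose f).
Proof. by apply: sset_homP => k [x s] /=; rewrite -sact_comp. Qed.

Lemma transpose_natr (K : sset) (Y Z : D) n (g : sc_map Y Z n)
    (f : sc_map (F K) Y n) :
  transpose (sc_comp g f) = sset_map_comp (rep_map A g) (transpose f).
Proof. by apply: sset_homP => k [x s] /=; rewrite sc_comp_act sc_compA. Qed.

Hypothesis eta_natural : forall (K L : sset) (f : sset_hom K L),
  sset_comp (rep_fmap A (fun_map F f)) (@eta K) = sset_comp (@eta L) f.
Hypothesis transpose_bij : forall K Y n, bijective (@transpose K Y n).

Let transposeI K Y n : injective (@transpose K Y n) := bij_inj (transpose_bij K Y n).

Let transpose_onto K Y n (k : sset_map K (sc_map A Y) n) :
  {f : sc_map (F K) Y n | transpose f = k}.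
Proof. by apply: cid; have [g _ gK] := transpose_bij K Y n; exists (g k). Qed.

Program Definition unit_after (K L : sset) n (k : sset_map K L n) :
    sset_map K (sc_map A (F L)) n :=
  @SSetHom _ _ (fun m x => eta m (k m x)) _.
Next Obligation. by move=> K L n k l m t x; rewrite -shom_act -shom_act. Qed.

(** The action of [F] on an n-simplex k of Map(K, L) is forced: its transpose has
to be the composite of k with the unit of L. *)
Definition copower_map (K L : sset) n (k : sset_map K L n) : sc_map (F K) (F L) n :=
  sval (transpose_onto (unit_after k)).

Lemma transpose_copower_map (K L : sset) n (k : sset_map K L n) :
  transpose (copower_map k) = unit_after k.
Proof. exact: svalP (transpose_onto (unit_after k)). Qed.

Lemma copower_mapE (K L : sset) n (k : sset_map K L n) m (x : K m) (s : ordmap m n) :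
  sc_comp (sact s (copower_map k)) (eta m x) = eta m (k m (x, s)).
Proof.
exact: (congr1 (fun h : sset_hom (sset_prod K (sset_simplex n)) (sc_map A (F L)) =>
  h m (x, s)) (transpose_copower_map k)).
Qed.

Program Definition copower_structure : @simplicial_structure sset_scat D F :=
  @SimplicialStructure sset_scat D F copower_map _ _ _.
Next Obligation.
move=> K L m n t k; apply: transposeI; rewrite transpose_act !transpose_copower_map.
exact: sset_homP.
Qed.
Next Obligation.
move=> K L M n g f; apply: transposeI; rewrite transpose_copower_map.
apply: sset_homP => m [x s] /=.
by rewrite sc_comp_act -sc_compA !copower_mapE.
Qed.
Next Obligation.
move=> K L f; apply: transposeI; rewrite transpose_copower_map.
apply: sset_homP => m [x s] /=; rewrite (ordmap_to0_uniq s).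
exact: esym (congr1 (fun h : sset_hom K (sc_map A (F L)) => h m x) (eta_natural f)).
Qed.

Program Definition copower_adjunction : simplicial_adjunction
    (SimplicialFunctor copower_structure) (rep_sfunctor A) :=
  @SimplicialAdjunction sset_scat D (SimplicialFunctor copower_structure)
    (rep_sfunctor A) transpose transpose_act transpose_bij _ _.
Next Obligation.
move=> K K' Y n f k; apply: sset_homP => m [x s] /=.
by rewrite sc_comp_act -sc_compA copower_mapE.
Qed.
Next Obligation. by move=> K Y Y' n g f; exact: transpose_natr. Qed.

(** The transpose along [eta] is natural by construction. Hence its being
bijective in all degrees determines the action of [F] on mapping spaces, and
each axiom of a simplicial functor is checked after transposing. *)
Lemma copower_left_adjoint : @simplicial_left_adjoint sset_scat D F (rep_sfunctor A).
Proof. by exists copower_structure; constructor; exact: copower_adjunction. Qed.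

End copower_adjunction.

(** * Points of simplices and common refinements *)

(** A monotone map given on a part of a chain extends to the chain by taking the
last prescribed value at or below each point; below the part, the first
prescribed value serves. All values are thus prescribed values. *)
Lemma monotone_extension (P : finType) (S : {pred P}) (p1 : P) N q
    (rank : P -> 'I_N.+1) (pr : P -> 'I_q.+1) : S p1 ->
  (forall p p', S p -> S p' -> (rank p <= rank p')%N -> (pr p <= pr p')%N) ->
  exists2 a : ordmap N q,
    forall p, S p -> a (rank p) = pr p & forall k, exists2 p, S p & a k = pr p.
Proof.
move=> Sp1 mono.
have [p0 Sp0 p0_min] := arg_minnP rank Sp1.
pose below k p := (S p && (rank p <= k)%N) || (p == p0).
pose v k := (\max_(p | below k p) pr p)%N.
have v_lt k : (v k < q.+1)%N by rewrite ltnS; apply/bigmax_leqP => p _; rewrite -ltnS.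
have v_homo : {homo (fun k : 'I_N.+1 => Ordinal (v_lt k)) : i j / (i <= j)%N}.
  move=> i j ij /=; apply/bigmax_leqP => p hp; apply: leq_bigmax_cond.
  case/orP: hp => [/andP[Sp pi]|/eqP ->]; rewrite /below ?eqxx ?orbT //.
  by rewrite Sp (leq_trans pi ij).
exists (OMap v_homo) => [p Sp|k].
  apply: val_inj => /=; apply/eqP; rewrite eqn_leq; apply/andP; split.
    apply/bigmax_leqP => p' /orP[/andP[Sp' /mono]|/eqP ->]; first exact.
    by apply: mono => //; exact: p0_min.
  by apply: (leq_bigmax_cond (F := pr)); rewrite /below Sp leqnn.
have [|p hp vp] := @eq_bigmax_cond _ (below k) (fun p => pr p : nat).
  by apply/card_gt0P; exists p0; rewrite unfold_in /below eqxx orbT.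
exists p; last exact: val_inj.
by case/orP: hp => [/andP[]|/eqP ->].
Qed.

Section barycentric.
Variable R : realType.

Definition bary n (x : simplex R n) (i : 'I_n.+1) : R := val x ord0 i.

Lemma bary_ge0 n (x : simplex R n) i : 0 <= bary x i.
Proof. by have [x0 _] := set_mem (valP x); exact: x0. Qed.

Lemma bary_sum n (x : simplex R n) : \sum_i bary x i = 1.
Proof. by have [_] := set_mem (valP x). Qed.

Lemma baryP n (x y : simplex R n) : bary x =1 bary y -> x = y.
Proof. by move=> xy; apply: val_inj; apply/rowP => i; exact: xy. Qed.

Lemma bary_map m n (t : ordmap m n) (x : simplex R m) j :
  bary (simplex_map t x) j = \sum_(i | t i == j) bary x i.
Proof. by rewrite /bary mxE. Qed.

Lemma bary_onto n (f : 'I_n.+1 -> R) : (forall i, 0 <= f i) -> \sum_i f i = 1 ->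
  exists x : simplex R n, bary x =1 f.
Proof.
move=> f0 f1; have fP : \row_i f i \in @simplex_set R n.
  apply/mem_set; split=> [i|]; first by rewrite mxE.
  by rewrite -f1; apply: eq_bigr => i _; rewrite mxE.
by exists (SigSub fP) => i; rewrite /bary /= mxE.
Qed.

Lemma bary_pos n (x : simplex R n) : exists i, 0 < bary x i.
Proof.
apply: contrapT => /forallNP h; have := bary_sum x; rewrite big1.
  by move=> /eqP; rewrite eq_sym oner_eq0.
by move=> i _; apply/eqP; rewrite eq_le bary_ge0 andbT leNgt; exact/negP/h.
Qed.

(** If [u i < v i] with [i] in the support, then the initial segment
[v <= u i] lies strictly below [i] whereas [u <= u i] reaches [i], so the two
image points give different mass to the vertices up to [u i]. *)
Lemma simplex_map_support m n (u v : ordmap m n) (x : simplex R m) :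
  simplex_map u x = simplex_map v x -> forall i, 0 < bary x i -> u i = v i.
Proof.
suff le (t s : ordmap m n) : simplex_map t x = simplex_map s x ->
    forall i, 0 < bary x i -> (s i <= t i)%N.
  by move=> uv i xi; apply: val_inj; apply/eqP; rewrite eqn_leq !le.
move=> ts i xi; rewrite leqNgt; apply/negP => lt_ts.
have mass (r : ordmap m n) : \sum_(j < n.+1 | (j <= t i)%N) bary (simplex_map r x) j
    = \sum_(k < m.+1 | (r k <= t i)%N) bary x k.
  rewrite (partition_big r (fun j : 'I_n.+1 => (j <= t i)%N)) //=.
  apply: eq_bigr => j jt; rewrite bary_map; apply: eq_bigl => k.
  by case: eqP => [->|]; rewrite ?andbF ?andbT.
have := mass t; rewrite ts mass [RHS](bigD1 i) //= => e.
suff: \sum_(k < m.+1 | (s k <= t i)%N) bary x k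
    <= \sum_(k < m.+1 | (t k <= t i)%N && (k != i)) bary x k.
  by rewrite e gerDr leNgt xi.
rewrite big_mkcond [leRHS]big_mkcond; apply: ler_sum => k _.
have [sk|_] := boolP (s k <= t i)%N; last by case: ifP => // _; exact: bary_ge0.
have ki : (k < i)%N.
  rewrite ltnNge; apply/negP => /(ordmap_homo s) ik.
  by move: lt_ts; rewrite ltnNge (leq_trans ik).
by rewrite ordmap_homo ?(ltnW ki) //= ifT // -(inj_eq val_inj) /= ltn_eqF.
Qed.

Section coupling.
Variables (m n : nat) (x : simplex R m) (y : simplex R n).

Definition cumul l (z : simplex R l) (i : nat) : R :=
  \sum_(k < l.+1 | (k < i)%N) bary z k.

Lemma cumul0 l (z : simplex R l) : cumul z 0 = 0.
Proof. by rewrite /cumul big_pred0. Qed.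

Lemma cumulT l (z : simplex R l) : cumul z l.+1 = 1.
Proof. by rewrite -(bary_sum z); apply: eq_bigl => k; exact: ltn_ord. Qed.

Lemma cumulS l (z : simplex R l) (i : 'I_l.+1) : cumul z i.+1 = cumul z i + bary z i.
Proof.
rewrite /cumul (bigD1 i) //= addrC; congr (_ + _); apply: eq_bigl => k.
by rewrite ltnS [RHS]ltn_neqAle andbC -(inj_eq val_inj).
Qed.

Lemma cumul_homo l (z : simplex R l) i j : (i <= j)%N -> cumul z i <= cumul z j.
Proof.
move=> ij; rewrite /cumul big_mkcond [leRHS]big_mkcond; apply: ler_sum => k _.
have [ki|_] := boolP (k < i)%N; first by rewrite (leq_trans ki ij).
by case: ifP => // _; exact: bary_ge0.
Qed.

Lemma cumul_ge0 l (z : simplex R l) i : 0 <= cumul z i.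
Proof. by rewrite -(cumul0 z) cumul_homo. Qed.

Lemma cumul_le1 l (z : simplex R l) i : cumul z i <= 1.
Proof.
rewrite -(bary_sum z) /cumul big_mkcond; apply: ler_sum => k _.
by case: ifP => // _; exact: bary_ge0.
Qed.

(** The barycentric coordinates of [x] and [y] are the lengths of two partitions
of the unit interval; this is the length of the intersection of the interval
[p.1] of the first one with the interval [p.2] of the second, written as a mixed
difference so that the sum over either index telescopes. *)
Definition overlap (p : 'I_m.+1 * 'I_n.+1) : R :=
  Num.min (cumul x p.1.+1) (cumul y p.2.+1) - Num.min (cumul x p.1) (cumul y p.2.+1)
  - (Num.min (cumul x p.1.+1) (cumul y p.2) - Num.min (cumul x p.1) (cumul y p.2)).

Lemma overlap_sum1 i : \sum_j overlap (i, j) = bary x i.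
Proof.
pose d k := Num.min (cumul x i.+1) (cumul y k) - Num.min (cumul x i) (cumul y k).
transitivity (\sum_(0 <= j < n.+1) (d j.+1 - d j)); first by rewrite big_mkord.
rewrite telescope_sumr // /d cumulT cumul0 !(min_r (cumul_ge0 x _)) subrr subr0.
by rewrite !min_l ?cumul_le1 // cumulS addrC addKr.
Qed.

Lemma overlap_sum2 j : \sum_i overlap (i, j) = bary y j.
Proof.
pose d k := Num.min (cumul x k) (cumul y j.+1) - Num.min (cumul x k) (cumul y j).
transitivity (\sum_(0 <= i < m.+1) (d i.+1 - d i)).
  by rewrite big_mkord; apply: eq_bigr => i _; rewrite /overlap /d /=; lra.
rewrite telescope_sumr // /d cumulT cumul0 !(min_l (cumul_ge0 y _)) subrr subr0.
by rewrite !min_r ?cumul_le1 // cumulS addrC addKr.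
Qed.

Lemma overlap_ge0 p : 0 <= overlap p.
Proof.
have := cumul_homo x (leqnSn p.1); have := cumul_homo y (leqnSn p.2).
rewrite /overlap !minEle; move: (cumul x _) (cumul x _) (cumul y _) (cumul y _) => a b c d.
by case: (lerP b d); case: (lerP a d); case: (lerP b c); case: (lerP a c); lra.
Qed.

Lemma overlap_gt0 p : 0 < overlap p ->
  cumul x p.1 < cumul y p.2.+1 /\ cumul y p.2 < cumul x p.1.+1.
Proof.
have := cumul_homo x (leqnSn p.1); have := cumul_homo y (leqnSn p.2).
rewrite /overlap !minEle; move: (cumul x _) (cumul x _) (cumul y _) (cumul y _) => a b c d.
by case: (lerP b d); case: (lerP a d); case: (lerP b c); case: (lerP a c); lra.
Qed.

(** The intervals of the common refinement come in order, so the pairs of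
overlapping intervals form a chain, on which [p.1 + p.2] is a strict rank. *)
Lemma overlap_chain p q : 0 < overlap p -> 0 < overlap q ->
  (p.1 + p.2 <= q.1 + q.2)%N -> (p.1 <= q.1)%N /\ (p.2 <= q.2)%N.
Proof.
move=> /overlap_gt0[p12 p21] /overlap_gt0[q12 q21] pq.
split; rewrite leqNgt; apply/negP => h.
  have h' : (p.2 < q.2)%N by lia.
  have := cumul_homo x h; have := cumul_homo y h'; lra.
have h' : (p.1 < q.1)%N by lia.
have := cumul_homo x h'; have := cumul_homo y h; lra.
Qed.

Lemma rank_lt (p : 'I_m.+1 * 'I_n.+1) : (p.1 + p.2 < (m + n).+1)%N.
Proof. by rewrite ltnS leq_add // -ltnS. Qed.

(** The refinement places the mass of an overlapping pair at its rank in
[0, m + n], where the two projections extend to monotone maps. A dimension that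
does not depend on the points makes the cover of a product of simplices by the
maps [(u, s)] finite. *)
Lemma common_refinement : exists u : ordmap (m + n) m, exists s : ordmap (m + n) n,
  exists z : simplex R (m + n), simplex_map u z = x /\ simplex_map s z = y.
Proof.
pose rank p := Ordinal (rank_lt p).
have total : \sum_p overlap p = 1.
  rewrite -(bary_sum x) -(pair_bigA _ (fun i j => overlap (i, j))) /=.
  by apply: eq_bigr => i _; exact: overlap_sum1.
have [p1 p1_gt0] : exists p, 0 < overlap p.
  apply: contrapT => /forallNP h; move: total; rewrite big1.
    by move=> /eqP; rewrite eq_sym oner_eq0.
  by move=> p _; apply/eqP; rewrite eq_le overlap_ge0 andbT leNgt; exact/negP/h.
have [z zE] : exists z : simplex R (m + n),
    bary z =1 (fun k => \sum_(p | rank p == k) overlap p).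
  apply: bary_onto => [k|]; first by apply: sumr_ge0 => p _; exact: overlap_ge0.
  by rewrite -total [RHS](partition_big rank xpredT).
have push q (pr : 'I_m.+1 * 'I_n.+1 -> 'I_q.+1) (a : ordmap (m + n) q) j :
    (forall p, 0 < overlap p -> a (rank p) = pr p) ->
    bary (simplex_map a z) j = \sum_(p | pr p == j) overlap p.
  move=> aE; rewrite bary_map.
  transitivity (\sum_(p | a (rank p) == j) overlap p).
    rewrite [RHS](partition_big rank (fun k => a k == j)) //=.
    apply: eq_bigr => k ak; rewrite zE; apply: eq_bigl => p.
    by case: eqP => [->|]; rewrite ?andbF ?andbT.
  rewrite big_mkcond [RHS]big_mkcond; apply: eq_bigr => p _.
  have := overlap_ge0 p; rewrite le_eqVlt => /orP[/eqP <-|/aE -> //].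
  by rewrite !if_same.
have [u uE _] := @monotone_extension _ (fun p => 0 < overlap p) p1 _ _ rank fst p1_gt0
  (fun p q hp hq h => (overlap_chain hp hq h).1).
have [s sE _] := @monotone_extension _ (fun p => 0 < overlap p) p1 _ _ rank snd p1_gt0
  (fun p q hp hq h => (overlap_chain hp hq h).2).
exists u, s, z; split; apply: baryP => k.
  rewrite (push _ _ _ _ uE) -overlap_sum1.
  transitivity (\sum_(i | i == k) \sum_j overlap (i, j)); last by rewrite big_pred1_eq.
  by rewrite pair_big /=; apply: eq_big => -[i j]; rewrite ?andbT.
rewrite (push _ _ _ _ sE) -overlap_sum2.
transitivity (\sum_i \sum_(j | j == k) overlap (i, j)).
  by rewrite pair_big /=; apply: eq_big => -[i j].
by apply: eq_bigr => i _; rewrite big_pred1_eq.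
Qed.

End coupling.

(** Monotone maps that agree on the support of a point need not be equal, but
they become so after precomposition with this [c], which fixes the point. *)
Lemma support_retract n (x : simplex R n) : exists c : ordmap n n,
  simplex_map c x = x /\ forall i, 0 < bary x (c i).
Proof.
have [i0 i0_gt0] := bary_pos x.
have [c cE cS] := @monotone_extension _ (fun i => 0 < bary x i) i0 _ _ id id i0_gt0
  (fun _ _ _ _ h => h).
exists c; split; last by move=> k; have [i xi ->] := cS k.
apply: baryP => j; rewrite bary_map big_mkcond -[RHS](big_pred1_eq +%R j (bary x)).
rewrite [RHS]big_mkcond; apply: eq_bigr => i _.
have := bary_ge0 x i; rewrite le_eqVlt => /orP[/eqP <-|/cE -> //].
by rewrite !if_same.
Qed.

(** For points [z] and [z'] with the same images take a common refinement [w]. The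
two resulting pairs of monotone maps have the same value at [w], so they agree
on its support, and after the retraction they are equal. *)
Lemma refinement_indep (V : Type) (m n : nat)
    (phi : forall l, ordmap l m -> ordmap l n -> simplex R l -> V) :
  (forall k l (t : ordmap k l) u s z,
    phi k (ordmap_comp u t) (ordmap_comp s t) z = phi l u s (simplex_map t z)) ->
  forall l u s z l' u' s' z',
  simplex_map u z = simplex_map u' z' -> simplex_map s z = simplex_map s' z' ->
  phi l u s z = phi l' u' s' z'.
Proof.
move=> phi_nat l u s z l' u' s' z' euz esz.
have [a [b [w [az bz']]]] := common_refinement z z'.
have [c [cw c_gt0]] := support_retract w.
have agree q (v : ordmap l q) (v' : ordmap l' q) :
    simplex_map v z = simplex_map v' z' ->
    ordmap_comp (ordmap_comp v a) c = ordmap_comp (ordmap_comp v' b) c.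
  move=> vz; apply: ordmapP => i; apply: (simplex_map_support (x := w)) (c_gt0 i).
  by rewrite !simplex_map_comp az bz'.
by rewrite -az -bz' -!phi_nat -[in LHS]cw -[in RHS]cw -!phi_nat (agree _ _ _ euz) (agree _ _ _ esz).
Qed.

End barycentric.

(** * Finite simplicial sets *)

Lemma ordmap_finite m n : finite_set [set: ordmap m n].
Proof.
pose F (t : ordmap m n) := [ffun i => t i].
have injF : injective F.
  by move=> t u /ffunP tu; apply: ordmapP => i; have := tu i; rewrite !ffunE.
rewrite -(preimage_setT F); apply: finite_preimage; first by move=> t u _ _ /injF.
exact: finite_finset.
Qed.

(** As [m > n], two consecutive vertices have the same image, and [t] factors
through the codegeneracy that merges them. *)
Lemma ordmap_factor m n (t : ordmap m n) : (n < m)%N ->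
  exists l (d : ordmap l n) (s : ordmap m l),
    [/\ (l < m)%N, forall j, exists i, s i = j & t = ordmap_comp d s].
Proof.
case: m t => // m t nm.
(* Otherwise [t] would be strictly increasing, hence at least the identity. *)
have [i im tiS] : exists2 i, (i < m.+1)%N & t (inord i) = t (inord i.+1).
  apply: contrapT => /forall2NP h.
  have mono k : (k < m.+2)%N -> (k <= t (inord k))%N.
    elim: k => // k ih km; apply: leq_ltn_trans (ih (ltnW km)) _.
    have kS : (t (inord k) <= t (inord k.+1))%N.
      by apply: ordmap_homo; rewrite !inordK // ltnW.
    rewrite ltn_neqAle kS andbT.
    by apply/negP => /eqP/val_inj tk; case: (h k) => //; apply.
  have := leq_trans (mono m.+1 (ltnSn _)) (ltn_ord (t (inord m.+1)) : (_ <= n)%N).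
  by rewrite leqNgt nm.
have s_lt (k : 'I_m.+2) : (unbump i k < m.+1)%N.
  by have := ltn_ord k; rewrite /unbump; case: (ltnP i k); lia.
have d_lt (k : 'I_m.+1) : (bump i.+1 k < m.+2)%N.
  by have := ltn_ord k; rewrite /bump; case: (ltnP i k); lia.
have s_homo : {homo (fun k : 'I_m.+2 => Ordinal (s_lt k)) : j k / (j <= k)%N}.
  by move=> j k jk /=; rewrite /unbump; case: (ltnP i j); case: (ltnP i k); lia.
have d_homo : {homo (fun k : 'I_m.+1 => t (Ordinal (d_lt k))) : j k / (j <= k)%N}.
  by move=> j k jk; apply: ordmap_homo; rewrite /= leq_bump2.
exists m, (OMap d_homo), (OMap s_homo); split=> // [j|].
  exists (Ordinal (d_lt j)); apply: val_inj => /=.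
  by rewrite /bump /unbump; case: (ltnP i j); lia.
apply: ordmapP => k /=; have [ki|ki] := eqVneq (k : nat) i.+1.
  have -> : k = inord i.+1 by apply: val_inj; rewrite /= inordK.
  rewrite -tiS; congr (t _); apply: val_inj.
  rewrite [LHS]inordK ?(leqW im) //= inordK //.
  by rewrite /bump /unbump; lia.
congr (t _); apply: val_inj => /=.
by rewrite /bump /unbump; case: (ltnP i k); lia.
Qed.

Program Definition generated (K : sset) n (x : K n) : ssubset K :=
  @SSubset K (fun m => range (fun t : ordmap m n => sact t x)) _.
Next Obligation.
by move=> K n x l m t _ [u _ <-]; exists (ordmap_comp u t); rewrite ?sact_comp.
Qed.

Lemma generated_self (K : sset) n (x : K n) : generated x n x.
Proof. by exists (ordmap_id n); rewrite ?sact_id. Qed.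

Lemma generated_sub (K : sset) n (x : K n) (L : ssubset K) :
  L n x -> forall m, generated x m `<=` L m.
Proof. by move=> Lx m _ [t _ <-]; exact: ssub_act. Qed.

(** By [ordmap_factor] the nondegenerate simplices of the subset generated by [x]
are faces [sact t x] with [t] starting in dimension at most [n]. *)
Lemma generated_finite (K : sset) n (x : K n) : finite_sset (ssub_sset (generated x)).
Proof.
pose face m (t : ordmap m n) : {m & ssub_sset (generated x) m} :=
  existT _ m (exist _ (sact t x) (ssub_act t (generated_self x))).
apply: (@sub_finite_set _ _ (\bigcup_(m in `I_n.+1) range (@face m))); last first.
  by apply: bigcup_finite => // m _; exact/finite_image/ordmap_finite.
case=> m [y [t yt xt]] ndy; exists m; last first.
  by exists t => //; rewrite /face; congr existT; exact: sub_eq.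
rewrite /= ltnS leqNgt; apply/negP => /(ordmap_factor t)[l [d [s [lm sS td]]]].
apply: ndy; exists l, s, (exist _ (sact d x) (ssub_act d (generated_self x))).
by split=> //; apply: sub_eq; rewrite /= -sact_comp -td.
Qed.

Definition fin_generated (K : sset) n (x : K n) : fin_ssubset K :=
  FinSSubset (generated_finite x).

Lemma nondegenerate_rep (K : sset) n (x : K n) :
  exists m (y : K m) (t : ordmap n m), ~ degenerate y /\ x = sact t y.
Proof.
elim/ltn_ind: n x => n ih x.
have [[m [s [y [mn _ ->]]]]|ndx] := pselect (degenerate x); last first.
  by exists n, x, (ordmap_id n); rewrite sact_id.
have [l [z [t [ndz ->]]]] := ih m mn y.
by exists l, z, (ordmap_comp t s); rewrite sact_comp.
Qed.

(** * Joint continuity *)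

Lemma filter_finite_forall (T I : Type) (D : set I) (F : set_system T)
    (P : I -> set T) : Filter F -> finite_set D -> (forall i, D i -> F (P i)) ->
  F [set x | forall i, D i -> P i x].
Proof.
move=> FF; elim/Pchoice: I => I in D P *.
move=> /finite_fsetP[X ->] FP; apply: filterS (filter_bigI FF FP) => x Px i Xi.
exact: Px.
Qed.

(** A finite family of maps from compact spaces onto a Hausdorff space is a closed
cover, hence a quotient map. *)
Lemma finite_cover_continuous (X Y : topologicalType) (I : Type) (D : set I)
    (Z : I -> compHaus) (q : forall i, Z i -> X) (g : X -> Y) :
  hausdorff_space X -> finite_set D -> (forall i, continuous (q i)) ->
  (forall x, exists2 i, D i & exists z, q i z = x) ->
  (forall i, continuous (g \o q i)) -> continuous g.
Proof.
move=> hX; elim/Pchoice: I => I in D Z q *.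
move=> finD cq cov cgq; apply/continuous_closedP => C cC.
have -> : g @^-1` C = \bigcup_(i in D) (q i @` ((g \o q i) @^-1` C)).
  apply/seteqP; split=> [x Cx|_ [i Di [z Cz <-]]] //.
  by have [i Di [z qz]] := cov x; exists i => //; exists z => //=; rewrite qz.
apply: closed_bigcup => // i Di; apply: compact_closed => //.
apply: continuous_compact; first exact/continuous_subspaceT/cq.
apply: (subclosed_compact _ (@ch_compact (Z i))) => //.
by apply: (proj1 (continuous_closedP _)) => //; exact: cgq.
Qed.

Lemma continuous_pair (T X Y : topologicalType) (f : T -> X) (g : T -> Y) :
  continuous f -> continuous g -> continuous (fun t => (f t, g t)).
Proof.
move=> cf cg t; apply: (@cvg_pair _ _ _ _ (nbhs (f t)) (nbhs (g t))).
  exact: cf.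
exact: cg.
Qed.

Lemma hausdorff_pair (X Y : topologicalType) :
  hausdorff_space X -> hausdorff_space Y -> hausdorff_space (X * Y)%type.
Proof.
move=> hX hY [x y] [x' y'] cl; congr pair.
  apply: hX => U V xU xV.
  have [||z [[Uz _] [Vz _]]] := cl (U `*` setT) (V `*` setT); last by exists z.1.
    by exists (U, setT) => //; split=> //; exact: filterT.
  by exists (V, setT) => //; split=> //; exact: filterT.
apply: hY => U V xU xV.
have [||z [[_ Uz] [_ Vz]]] := cl (setT `*` U) (setT `*` V); last by exists z.2.
  by exists (setT, U) => //; split=> //; exact: filterT.
by exists (setT, V) => //; split=> //; exact: filterT.
Qed.

Section joint_continuity.
Variables (R : realType) (G : topologicalGroupType) (nu : cardinal).
Local Notation lmc := (lmc_algebra R G nu).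

(** Joint continuity at all points of the compact space [X] is uniform over [X],
by the tube lemma. *)
Lemma cx_curry_continuous (T : topologicalType) (X : compHaus) (B : lmc)
    (phi : T -> cx X B) :
  continuous (fun z : T * X => cx_eval (phi z.1) z.2) -> continuous phi.
Proof.
move=> cphi t.
apply: (@seminorm_nbhs_sub _ _ _ _ _ (@fmap_filter _ _ _ _ (nbhs_filter t))).
move=> _ e [p hp <-] e0; have [[sp _ _ _] _ cp] := hp.
have e20 : 0 < e / 2 by rewrite divr_gt0.
have e40 : 0 < e / 2 / 2 by rewrite divr_gt0.
have cov : near_covering [set: X] by apply/compact_near_coveringP; exact: ch_compact.
have := cov T (nbhs t) (fun s x =>
  p (cx_eval (phi s) x - cx_eval (phi t) x) <= e / 2) (nbhs_filter t).
move=> /(_ _)/wrap[].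
  move=> x0 _.
  have [[U V] /= [tU xV] UV] := cphi (t, x0) _ (near_cinv _ sp cp e40).
  exists (V, U) => //= -[x s] /= [Vx Us].
  apply: le_trans (snB sp (cx_eval (phi t) x0) _ _) _.
  rewrite [X in _ + X](sn_sub sp) [e / 2]splitr lerD // ltW //.
    exact: (UV (s, x) (conj Us Vx)).
  exact: (UV (t, x) (conj (nbhs_singleton tU) Vx)).
apply: filterS => s hs; apply: le_lt_trans (_ : e / 2 < e).
  by apply: Defs.sup_le => [|x]; [exact: ltW|exact: hs].
by rewrite ltr_pdivrMr // ltr_pMr // ltr1n.
Qed.

Program Definition cx_family (A : galgebra R G) (X : compHaus) (B : lmc)
    (g : X -> ghom A B) (cg : continuous (fun z : A * X => g z.2 z.1)) :
    ghom A (cx X B) :=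
  @GHom _ _ A (cx X B) (fun a => @mk_cfun _ _ X B (fun x => g x a) _) _ _ _ _ _ _.
Next Obligation.
move=> A X B g cg a x.
apply: (@continuous_comp _ _ _ (fun x => (a, x)) (fun z : A * X => g z.2 z.1)).
  by apply: cvg_pair => /=; [exact: cvg_cst|exact: cvg_id].
exact: cg.
Qed.
Next Obligation. by move=> A X B g cg a b; apply: cfunP => x; exact: ghomD. Qed.
Next Obligation. by move=> A X B g cg z a; apply: cfunP => x; exact: ghomZ. Qed.
Next Obligation. by move=> A X B g cg a b; apply: cfunP => x; exact: ghomM. Qed.
Next Obligation. by move=> A X B g cg a; apply: cfunP => x; exact: ghomS. Qed.
Next Obligation. by move=> A X B g cg h a; apply: cfunP => x; exact: ghom_act. Qed.
Next Obligation. by move=> A X B g cg; exact: cx_curry_continuous. Qed.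

(** Writing [g y b - g x a] as [g y (b - a)] plus [g y a - g x a], the second term
is small by continuity at fixed [a], and the first one uniformly in [y], being a
value of one of finitely many continuous morphisms into algebras of functions. *)
Lemma finite_cover_joint_continuous (X : topologicalType) (I : Type) (D : set I)
    (Z : I -> compHaus) (q : forall i, Z i -> X) (A : galgebra R G) (B : lmc)
    (g : X -> ghom A B) (f : forall i, ghom A (cx (Z i) B)) :
  finite_set D -> (forall x, exists2 i, D i & exists z, q i z = x) ->
  (forall i z a, g (q i z) a = cx_eval (f i a) z) ->
  (forall a, continuous (fun x => g x a)) ->
  continuous (fun z : A * X => g z.2 z.1).
Proof.
move=> finD cov gf cg [a x]; apply: (@lmc_cvg _ _ B _ _ (lmc_lmc B)
  (@fmap_filter _ _ _ _ (nbhs_filter (a, x)))) => p e hp e0.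
have [[sp _ _ _] _ cp] := hp; have e20 : 0 < e / 2 by rewrite divr_gt0.
exists ([set b | forall i, D i -> forall z, p (cx_eval (f i b) z - cx_eval (f i a) z) < e / 2],
  [set y | p (g y a - g x a) < e / 2]).
  split; last exact: (cg a x _ (near_cinv _ sp cp e20)).
  apply: (@filter_finite_forall _ _ D _ _ (nbhs_filter a)) => // i Di.
  exact: (@ghom_continuous _ _ _ _ (f i) a _ (near_cx (f i a) hp e20)).
case=> b y /= [hb hy]; apply: le_lt_trans (snB sp (g y a) _ _) _.
rewrite [e]splitr ltrD //; have [i Di [z <-]] := cov y.
by rewrite !gf; exact: hb.
Qed.

End joint_continuity.

(** * Gluing over a product of simplices *)

Section product_gluing.
Variables (R : realType) (G : topologicalGroupType) (nu : cardinal).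
Local Notation lmc := (lmc_algebra R G nu).
Variables (A B : lmc) (m n : nat).
Variable phi : forall l, ordmap l m -> ordmap l n -> ghom A (cx (simplex R l) B).
Hypothesis phi_act : forall k l (t : ordmap k l) u s a z,
  cx_eval (phi (ordmap_comp u t) (ordmap_comp s t) a) z
  = cx_eval (phi u s a) (simplex_map t z).

Let glued : exists psi : simplex R m * simplex R n -> ghom A B,
  forall l (u : ordmap l m) (s : ordmap l n) z,
    psi (simplex_map u z, simplex_map s z) = ghom_comp (cx_ev B z) (phi u s).
Proof.
have [|psi psiE] := @choice (simplex R m * simplex R n)%type (ghom A B)
    (fun pq v => forall l (u : ordmap l m) (s : ordmap l n) z,
      simplex_map u z = pq.1 -> simplex_map s z = pq.2 ->
      v = ghom_comp (cx_ev B z) (phi u s)).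
  move=> [p q]; have [u [s [z [up sq]]]] := common_refinement p q.
  exists (ghom_comp (cx_ev B z) (phi u s)) => l u' s' z' /= up' sq'.
  apply: (refinement_indep (phi := fun l u s z => ghom_comp (cx_ev B z) (@phi l u s))).
  - by move=> i j t v r w; apply: ghomP => a; exact: phi_act.
  - by rewrite up.
  - by rewrite sq.
by exists psi => l u s z; exact: psiE.
Qed.

(** A family of morphisms over the simplices of [Delta[m] x Delta[n]] that
respects the simplicial relations glues over the product of the realizations:
it is well defined by [refinement_indep], jointly continuous by the finite cover
with [l = m + n], and the function algebra of the product is then reached by
currying twice. *)
Lemma product_glue : exists h : ghom A (cx (simplex R m) (cx (simplex R n) B)),
  forall l (u : ordmap l m) (s : ordmap l n) z a,
    cx_eval (cx_eval (h a) (simplex_map u z)) (simplex_map s z) = cx_eval (phi u s a) z.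
Proof.
have [psi psiE] := glued.
pose q (us : ordmap (m + n) m * ordmap (m + n) n) (z : simplex R (m + n)) :=
  (simplex_map us.1 z, simplex_map us.2 z).
have cq us : continuous (q us).
  apply: (@continuous_pair _ _ _ (simplex_map us.1) (simplex_map us.2));
    exact: simplex_map_continuous.
have fin : finite_set [set: ordmap (m + n) m * ordmap (m + n) n].
  by rewrite -setXTT; apply: finite_setX; exact: ordmap_finite.
have cov y : exists2 us, [set: ordmap (m + n) m * ordmap (m + n) n] us &
    exists z, q us z = y.
  case: y => x y; have [u [s [z [<- <-]]]] := common_refinement x y.
  by exists (u, s) => //; exists z.
have cpsi : continuous
    (fun w : A * (simplex R m * simplex R n)%type => psi w.2 w.1).
  apply: (@finite_cover_joint_continuous _ _ _ _ _ _ (fun=> simplex R (m + n)) q _ _ _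
    (fun us => phi us.1 us.2) fin cov).
  - by move=> us z a; rewrite /q psiE.
  - move=> a; apply: (finite_cover_continuous _ fin cq cov).
      by apply: hausdorff_pair; exact: ch_hausdorff.
    move=> us; rewrite (_ : _ \o _ = cx_eval (phi us.1 us.2 a)).
      exact: cx_eval_continuous.
    by apply/funext => z; rewrite /q /= psiE.
have cinner x : continuous (fun w : A * simplex R n => psi (x, w.2) w.1).
  move=> w; apply: (@continuous_comp _ _ _ (fun w : A * simplex R n => (w.1, (x, w.2)))
    (fun w : A * (simplex R m * simplex R n)%type => psi w.2 w.1)); last exact: cpsi.
  apply: (@continuous_pair _ _ _ fst (fun w => (x, w.2))); first by move=> v; exact: cvg_fst.
  apply: (@continuous_pair _ _ _ (fun=> x) snd); first exact: cst_continuous.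
  by move=> v; exact: cvg_snd.
pose inner x : ghom A (cx (simplex R n) B) :=
  cx_family (g := fun y => psi (x, y)) (cinner x).
have couter : continuous (fun w : A * simplex R m => inner w.2 w.1).
  apply: cx_curry_continuous => w.
  apply: (@continuous_comp _ _ _
    (fun w : A * simplex R m * simplex R n => (w.1.1, (w.1.2, w.2)))
    (fun w : A * (simplex R m * simplex R n)%type => psi w.2 w.1)); last exact: cpsi.
  apply: (@continuous_pair _ _ _ (fst \o fst) (fun w => (w.1.2, w.2))).
    by move=> v; apply: continuous_comp; exact: cvg_fst.
  apply: (@continuous_pair _ _ _ (snd \o fst) snd); last by move=> v; exact: cvg_snd.
  by move=> v; apply: continuous_comp; [exact: cvg_fst|exact: cvg_snd].
exists (cx_family (g := inner) couter) => l u s z a.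
exact: (congr1 (fun h : ghom A B => h a) (psiE l u s z)).
Qed.

End product_gluing.

(** * The universal family of copies of [A] *)

Section tensor_unit.
Variables (R : realType) (G : topologicalGroupType) (nu : cardinal).
Local Notation lmc := (lmc_algebra R G nu).
Variable A : lmc.

Section cellwise.
Variables (L : sset) (B : lmc) (k : sset_hom L (lmc_hom A B)).

Definition cell_ghom (c : cells R L) : ghom A B :=
  ghom_comp (cx_ev B (projT2 c)) (k _ (projT2 (projT1 c))).

Lemma cell_ghom_eq c d : cell_eq c d -> cell_ghom c = cell_ghom d.
Proof.
move=> /asboolP; elim=> {c d} [_ _ [m n t x p]|//|c d _ ->//|c d e _ -> _ ->//].
by apply: ghomP => a; rewrite /cell_ghom /= shom_act.
Qed.

Definition point_ghom (y : realization R L) : ghom A B := cell_ghom (realize_repr y).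

Lemma point_ghomE n (x : L n) p :
  point_ghom (realize_pi (cell x p)) = ghom_comp (cx_ev B p) (k n x).
Proof. by apply: (@cell_ghom_eq _ (cell x p)); apply/realize_piP; exact: realize_reprK. Qed.

(** The nondegenerate cells are finitely many compact sets covering [|L|]; at a
fixed [a] continuity can be checked cell by cell, [|L|] being a quotient of the
coproduct of its cells. *)
Lemma point_ghom_continuous : finite_sset L ->
  continuous (fun z : A * realization R L => point_ghom z.2 z.1).
Proof.
move=> finL; pose q (c : {n & L n}) (p : simplex R (projT1 c)) := realize_pi (cell (projT2 c) p).
apply: (@finite_cover_joint_continuous _ _ _ _ _ _ (fun c => simplex R (projT1 c)) q _ _ _
  (fun c => k _ (projT2 c)) finL).
- move=> y; case ey : (realize_repr y) => [[n x] p] /=.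
  have [m [z [t [ndz xz]]]] := nondegenerate_rep x.
  exists (existT _ m z) => //; exists (simplex_map t p).
  rewrite /q /= -[RHS]realize_reprK ey; apply: esym; apply/realize_piP/asboolP.
  by apply: Relation_Operators.rst_step; move: p {ey}; rewrite xz => p; exact: CellGlue.
- by move=> [n x] p a; rewrite point_ghomE.
- move=> a; apply/quotient_continuous/continuousP => U oU; apply/sigT_openP => -[n x].
  rewrite (_ : _ @^-1` _ = cx_eval (k n x a) @^-1` U).
    exact: (proj1 (continuousP _) (@cx_eval_continuous _ _ _ _ B (k n x a))).
  apply/funext => p.
  exact: (congr1 (fun h : ghom A B => U (h a)) (point_ghomE x p)).
Qed.

End cellwise.

Variable T : forall L : sset, finite_sset L -> tensor A (realization R L).

Lemma tensor_finite_desc (L : sset) (finL : finite_sset L) (B : lmc)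
    (k : sset_hom L (lmc_hom A B)) :
  exists phi : ghom (T finL) B,
    forall y, ghom_comp phi (tens_in (T finL) y) = point_ghom k y.
Proof.
by exists (tens_desc (T finL) (point_ghom_continuous (k := k) finL)) => y; rewrite tens_descE.
Qed.

Variable colim : forall K : sset, colimit (tens_diagram T K).
Local Notation F := (tens_ob colim).

Section copies.
Variable K : sset.

(** The copy of [A] at the point [p] of the cell [x], through a finite [L]
containing [x]. *)
Definition copy (L : fin_ssubset K) n (x : K n) (Lx : L n x) (p : simplex R n) :
    ghom A (F K) :=
  ghom_comp (tens_leg colim L)
    (tens_in (T (fsub_finite L)) (realize_pi (cell (exist _ x Lx : ssub_sset L n) p))).

Lemma copy_le (L L' : fin_ssubset K) (h : fin_ssubset_le L L') n (x : K n)
    (Lx : L n x) (Lx' : L' n x) p : copy Lx p = copy Lx' p.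
Proof.
rewrite /copy -(tens_leg_le colim h) -ghom_compA tens_mapE realize_mapE.
by congr (ghom_comp _ (tens_in _ (realize_pi (cell _ _)))); exact: sub_eq.
Qed.

(** Both sides are compared with the least choice, the subset generated by [x]. *)
Lemma copy_indep (L L' : fin_ssubset K) n (x : K n) (Lx : L n x) (Lx' : L' n x) p :
  copy Lx p = copy Lx' p.
Proof.
have sub (M : fin_ssubset K) : M n x -> fin_ssubset_le (fin_generated x) M.
  by move=> Mx m y; exact: generated_sub.
have gx : fin_generated x n x by exact: generated_self.
by rewrite -(copy_le (sub L Lx) gx) -(copy_le (sub L' Lx') gx).
Qed.

Lemma copy_act (L : fin_ssubset K) m n (t : ordmap m n) (x : K n) (Lx : L n x)
    (Ltx : L m (sact t x)) p : copy Ltx p = copy Lx (simplex_map t p).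
Proof.
congr (ghom_comp _ (tens_in _ _)); apply/realize_piP/asboolP.
apply: Relation_Operators.rst_step.
have -> : exist _ (sact t x) Ltx = sact t (exist _ x Lx : ssub_sset L n).
  exact: sub_eq.
exact: CellGlue.
Qed.

Lemma copy_continuous (L : fin_ssubset K) n (x : K n) (Lx : L n x) :
  continuous (fun z : A * simplex R n => copy Lx z.2 z.1).
Proof.
pose c p := realize_pi (cell (exist _ x Lx : ssub_sset L n) p) : realization R _.
move=> z; apply: (@continuous_comp _ _ _
  (fun z : A * simplex R n => tens_in (T (fsub_finite L)) (c z.2) z.1)
  (tens_leg colim L)); last exact: ghom_continuous.
apply: (@tens_map_subproof _ _ _ _ _ _ (T (fsub_finite L)) c).
move=> p; apply: continuous_comp; last exact: realize_pi_continuous.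
exact: existT_continuous.
Qed.

Program Definition copies : sset_hom K (lmc_hom A (F K)) :=
  @SSetHom K (lmc_hom A (F K))
    (fun n x => cx_family (@copy_continuous (fin_generated x) n x (generated_self x))) _.
Next Obligation.
move=> m n t x; apply: ghomP => a; apply: cfunP => p.
have gtx : fin_generated x m (sact t x) by exists t.
have e := @copy_indep (fin_generated (sact t x)) _ _ _ (generated_self _) gtx p.
rewrite (@copy_act (fin_generated x) _ _ _ _ (generated_self x)) in e.
exact: (congr1 (fun h : ghom A (F K) => h a) e).
Qed.

Lemma copiesE (L : fin_ssubset K) n (x : K n) (Lx : L n x) a p :
  cx_eval (copies n x a) p = copy Lx p a.
Proof.
exact: (congr1 (fun h : ghom A (F K) => h a)
  (@copy_indep (fin_generated x) _ _ _ (generated_self x) Lx p)).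
Qed.

(** The copies jointly detect morphisms: the points of all [|L|] are points of
cells, and [F K] is the colimit of the [A (x) |L|]. *)
Lemma copies_uniq (B : lmc) (f g : ghom (F K) B) :
  (forall n (x : K n) a p, f (cx_eval (copies n x a) p) = g (cx_eval (copies n x a) p)) ->
  f = g.
Proof.
move=> fg; apply: (tens_ob_uniq (colim := colim)) => L; apply: tens_uniq => y.
rewrite -[y]realize_reprK; case: (realize_repr y) => [[n [x Lx]] p].
by apply: ghomP => a; have := fg n x a p; rewrite !(copiesE Lx).
Qed.

Program Definition copies_cocone (B : lmc) (k : sset_hom K (lmc_hom A B)) :
    cocone (tens_diagram T K) :=
  @Cocone _ _ (tens_diagram T K) B (fun L => sval (cid
    (tensor_finite_desc (fsub_finite L)
      (@SSetHom (ssub_sset L) (lmc_hom A B) (fun n x => k n (sval x)) _)))) _.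
Next Obligation. by move=> B k L m n t x; exact: shom_act. Qed.
Next Obligation.
move=> B k L L' h /=; case: cid => phi' phi'E; case: cid => phi phiE /=.
apply: tens_uniq => y; rewrite -ghom_compA tens_mapE.
rewrite -[y]realize_reprK; case: (realize_repr y) => [[n x] p].
by rewrite realize_mapE phi'E phiE !point_ghomE.
Qed.

(** The restrictions of [k] to the finite subsets [L] induce morphisms out of
[A (x) |L|], which are compatible as they have the same value at each cell. *)
Lemma copies_desc (B : lmc) (k : sset_hom K (lmc_hom A B)) :
  exists f : ghom (F K) B, forall n (x : K n) a p,
    f (cx_eval (copies n x a) p) = cx_eval (k n x a) p.
Proof.
exists (colim_desc (colim K) (copies_cocone k)) => n x a p.
set L := fin_generated x; have Lx : L n x := generated_self x.
rewrite (copiesE Lx).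
have := colim_descE (colim K) (copies_cocone k) L => /=.
case: cid => phi phiE /= e.
have := phiE (realize_pi (cell (exist _ x Lx : ssub_sset L n) p)).
rewrite point_ghomE -e => /(congr1 (fun h : ghom _ _ => h a)).
by [].
Qed.

End copies.

Lemma copies_natural (K K' : sset) (f : sset_hom K K') :
  sset_comp (@rep_fmap (lmc_scat R G nu) A _ _ (tens_fmap colim f)) (copies K)
  = sset_comp (copies K') f.
Proof.
apply: sset_homP => n x; apply: ghomP => a; apply: cfunP => p.
pose L := fin_generated x; have Lx : L n x := generated_self x.
have fLx : fin_ssub_image f L n (f n x) by exists x.
transitivity (tens_fmap colim f (cx_eval (copies K n x a) p)) => //.
transitivity (cx_eval (copies K' n (f n x) a) p) => //.
rewrite (copiesE Lx) (copiesE fLx).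
have := congr1 (fun h : ghom _ (F K') => h (tens_in (T (fsub_finite L))
  (realize_pi (cell (exist _ x Lx : ssub_sset L n) p)) a)) (tens_fmapE colim f L).
move=> /= ->.
have := tens_mapE (T (fsub_finite L)) (T (fsub_finite (fin_ssub_image f L)))
  (@realize_map_continuous R _ _ (ssub_restr f L))
  (realize_pi (cell (exist _ x Lx : ssub_sset L n) p)).
move=> /(congr1 (fun h : ghom A _ => h a)) /= e.
rewrite [fin_map _ _ _ _ _]e realize_mapE /cell_map /=.
congr (_ (tens_in _ (realize_pi (cell _ _)) a)).
exact: sub_eq.
Qed.

(** The transpose of [f] only sees the values of [f] on the copies at points [p] of
[|Delta^m|] evaluated at [|s| p] in [|Delta^n|]. Passing to the faces [sact u x],
these are the values at all pairs [(|u| z, |s| z)], that is, at all pairs of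
points. Conversely [product_glue] produces all values from such compatible ones. *)
Lemma copies_transpose_bij (K : sset) (B : lmc) n :
  bijective (@transpose (lmc_scat R G nu) A (tens_functor colim) copies K B n).
Proof.
pose tr (f : ghom (F K) (cx (simplex R n) B)) :
    sset_hom (sset_prod K (sset_simplex n)) (lmc_hom A B) :=
  @transpose (lmc_scat R G nu) A (tens_functor colim) copies K B n f.
have trE f m (x : K m) (s : ordmap m n) a p :
    cx_eval (tr f m (x, s) a) p
    = cx_eval (f (cx_eval (copies K m x a) p)) (simplex_map s p).
  by [].
rewrite -setTT_bijective; split=> // [f f' _ _ ff'|k _].
  have {}ff' : tr f = tr f' := ff'.
  apply: copies_uniq => m x a p; apply: (@cfunP _ _ (simplex R n) B) => q.
  have [u [s [z [<- <-]]]] := common_refinement p q.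
  (* The value at [(|u| z, |s| z)] is the transpose at the face [sact u x]. *)
  have := trE f _ (sact u x) s a z; rewrite ff' trE shom_act.
  exact: esym.
have glue m (x : K m) : exists h : ghom A (cx (simplex R m) (cx (simplex R n) B)),
    forall l (u : ordmap l m) (s : ordmap l n) z a,
    cx_eval (cx_eval (h a) (simplex_map u z)) (simplex_map s z)
    = cx_eval (shom_fun k (sact u x, s) a) z.
  apply: (product_glue (phi := fun l u s => shom_fun k (sact u x, s))).
  move=> i l t u s a z; rewrite sact_comp.
  by have -> := shom_act k t (sact u x, s).
pose h m (x : K m) := sval (cid (glue m x)).
have hE m (x : K m) := svalP (cid (glue m x)).
have h_act i m (t : ordmap i m) (x : K m) :
    h i (sact t x) = sact t (h m x : lmc_hom A (cx (simplex R n) B) m).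
  apply: ghomP => a; apply: cfunP => p; apply: (@cfunP _ _ (simplex R n) B) => q.
  have [u [s [z [<- <-]]]] := common_refinement p q.
  have := hE _ (sact t x) _ u s z a; rewrite -sact_comp -hE simplex_map_comp.
  exact.
have [f fE] := copies_desc (@SSetHom K (lmc_hom A (cx (simplex R n) B)) h h_act).
exists f => //; apply: sset_homP => m [x s]; apply: ghomP => a; apply: cfunP => p.
have := trE f m x s a p; rewrite fE /=.
(* The pair [(p, |s| p)] is refined by [p] itself. *)
have := hE _ x _ (ordmap_id m) s p a; rewrite simplex_map_id sact_id => -> .
exact.
Qed.

End tensor_unit.

Theorem corollary4p8 (R : realType) (G : topologicalGroupType)
    (G_lc : locally_compact [set: G]) (G_sc : @second_countable G)
    (nu : cardinal) (nu_ge : ([set: set (set nat)] #<= [set: nu])%card)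
    (A : lmc_algebra R G nu)
    (T : forall L : sset, finite_sset L -> tensor A (realization R L))
    (colim : forall K : sset, colimit (tens_diagram T K)) :
  @simplicial_left_adjoint sset_scat (lmc_scat R G nu)
    (tens_functor colim) (hom_functor A).
Proof.
exact: (@copower_left_adjoint (lmc_scat R G nu) A (tens_functor colim)
  (copies colim) (copies_natural colim) (copies_transpose_bij colim)).
Qed.
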